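(* Let $k\ge 2$. For any $m\in\{1,2,3,\dots\}\cup\{\infty\}$ there exist Fatou-Bieberbach domains $\Omega_j\subset\mathbb{C}^k$, where $j$ runs over $1\le j\le m$ if $m$ is finite and over all positive integers if $m=\infty$, such that, with $\Omega=\bigcup_{j}\Omega_j$: (i) $\Omega_i\cap\Omega_l=\emptyset$ for all indices $i\neq l$; (ii) for every $q\in\mathbb{C}^k\setminus\Omega$ we have $q\in\partial\Omega_i$ for all indices $i$.
   Context: A Fatou-Bieberbach domain in $\mathbb{C}^k$ is a proper subdomain (open connected subset different from $\mathbb{C}^k$) of $\mathbb{C}^k$ that is biholomorphic to $\mathbb{C}^k$. $\partial\Omega_i$ denotes the topological boundary of $\Omega_i$ in $\mathbb{C}^k$. *)

(* Defs.v *)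
From HB Require Import structures.
From mathcomp Require Import all_boot all_order all_algebra.
From mathcomp Require Import all_classical all_reals all_analysis.
From mathcomp Require Import complex.

Set Implicit Arguments.
Unset Strict Implicit.
Unset Printing Implicit Defensive.

Import Order.TTheory GRing.Theory Num.Theory.
Import numFieldNormedType.Exports.

Local Open Scope classical_set_scope.
Local Open Scope ring_scope.
Local Open Scope complex_scope.

(* MathComp-Analysis topologizes abstract numeric fields; this transfers the
   resulting normed space structure (over itself) to the concrete type R[i], so
   that 'rV[R[i]]_k is C^k with the sup norm and its usual topology. *)
HB.instance Definition _ (R : realType) := NormedModule.copy R[i] (R[i])^o.

Section FatouBieberbach.
Context {R : realType} {k : nat}.
Local Notation Ck := 'rV[R[i]]_k.
Implicit Types (U V : set Ck) (f g : Ck -> Ck).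

(* Since Ck is a normed space over R[i], [differentiable] asks for a continuous
   complex-linear differential. The values of f outside U are irrelevant when
   U is open. *)
Definition holomorphic_on U f := forall z, U z -> differentiable f z.

Definition biholomorphic U V := exists f g,
  [/\ holomorphic_on U f, holomorphic_on V g, set_bij U V f
    & {in U, cancel f g}].

Definition fatou_bieberbach U :=
  [/\ open U, connected U, U != setT & biholomorphic U setT].

End FatouBieberbach.

Definition boundary {T : topologicalType} (A : set T) : set T :=
  closure A `\` A°.

(* m = Some n is the finite case, m = None is the case m = oo. *)
Definition indices (m : option nat) : set nat :=
  if m is Some n then [set j | (1 <= j <= n)%N] else [set j | (1 <= j)%N].

(* Main.v *)
Require Import Defs.
From HB Require Import structures.
From mathcomp Require Import all_boot all_order all_algebra.
From mathcomp Require Import separable.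
From mathcomp Require Import all_classical all_reals all_analysis.
From mathcomp Require Import complex.
From mathcomp Require Import ring lra.

Set Implicit Arguments.
Unset Strict Implicit.
Unset Printing Implicit Defensive.

Import Order.TTheory GRing.Theory Num.Theory.
Import numFieldNormedType.Exports.

Local Open Scope classical_set_scope.
Local Open Scope ring_scope.
Local Open Scope complex_scope.

(** The domains are basins of attraction of a non-autonomous dynamical system
    of automorphisms of C^k.  Choose distinct points a_j on a coordinate axis,
    one for each index j, and an automorphism A that fixes every a_j with
    differential c times the identity, where c is small.  The system is
    z_(n+1) = A (theta_n z_n), where theta_n is an automorphism that fixes the
    a_j and is extremely close to the identity near each of them; Omega_j is
    the set of the initial points whose orbit tends to a_j.

    Basins are Fatou-Bieberbach domains ([basin_fatou_bieberbach]).  If Phi_n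
    is the n-th map of the orbit, the rescaled maps c^(-n) (Phi_n - a_j)
    converge on Omega_j, with Lipschitz estimates for their differences: the
    limit is differentiable because it is a limit for the Lipschitz seminorm
    ([differentiable_lim]), it is injective because each tail of the sequence
    is a Lipschitz-small perturbation of the identity, it is onto by Banach's
    fixed point argument ([blowup_lim_surj]), and its inverse is
    differentiable by [differentiable_inv].  Properness holds as the system
    has a fixed point outside Omega_j.

    The basins of distinct points are disjoint.  The boundary property comes
    from the choice of theta_n.  Enumerate the pairs (B, j) of a rational ball
    B and an index j.  If at stage n some point of B has an orbit that is
    still outside of the balls B(a_i, r), then theta_n moves one such point
    into B(a_j, r), so that B meets Omega_j ([move_in], [step]).  If there is
    no such point, theta_n is the identity and all of B falls into the basins.
    Hence if q lies in no basin, then each rational ball around q meets every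
    Omega_j, and q is in the boundary of each of them ([Omega_boundary]).

    The point p is moved by shears z + F(z_s) v with F = (X / X(p_s))^d * w,
    where X vanishes at the points a_i, is small on the balls that have to be
    preserved and is larger at p: for large d the shear does almost nothing
    near the a_i ([shear_reach]).  Shears also give A ([contracting_auto]):
    they carry the points a_j from one coordinate axis to another one and
    back, which allows to contract all the coordinates one after the other.

    All this needs entire functions P and Q of one variable with P zero
    exactly at the numbers alpha_j, Q(alpha_j) = 0 and Q'(alpha_j) = 1,
    uniformly in j ([common_boundary]).  For finitely many domains P and Q are
    polynomials, with alpha_j = 1, 2, 3, and so on; for infinitely many
    P(z) = Q(z) = exp z - 1, with the periods of exp as the alpha_j. *)

(** * Real-valued norms over the complex numbers *)

(** The norm of a normed space over R[i] takes its values in R[i], which is not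
    totally ordered; the estimates below are inequalities in R. *)
HB.lock Definition nr (R : realType) (V : normedModType R[i]) (x : V) : R :=
  complex.Re `|x|.
Arguments nr {R V} x.
Canonical nr_unlockable := Unlockable nr.unlock.

Section Norm.
Context {R : realType}.
Local Notation C := R[i].

Lemma nrE (V : normedModType C) (x : V) : `|x| = (nr x)%:C.
Proof. by rewrite unlock RRe_real // ger0_real. Qed.

Section NormedModule.
Variable V : normedModType C.
Implicit Types x y : V.
Lemma nr_ge0 x : 0 <= nr x.
Proof. by rewrite -ler0c -nrE. Qed.
Lemma nr0 : nr (0 : V) = 0.
Proof. by rewrite unlock normr0. Qed.
Lemma nrN x : nr (- x) = nr x.
Proof. by rewrite unlock normrN. Qed.
Lemma nrBC x y : nr (x - y) = nr (y - x).
Proof. by rewrite unlock distrC. Qed.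
Lemma nrD x y : nr (x + y) <= nr x + nr y.
Proof. by rewrite -lecR rmorphD /= -!nrE ler_normD. Qed.
Lemma nrB x y : nr (x - y) <= nr x + nr y.
Proof. by rewrite -(nrN y) nrD. Qed.
Lemma nr_eq0 x : (nr x == 0) = (x == 0).
Proof. by rewrite -[RHS]normr_eq0 nrE -(inj_eq (@complexI R)). Qed.
Lemma nrZ (a : C) x : nr (a *: x) = nr a * nr x.
Proof. by apply: (@complexI R); rewrite rmorphM /= -!nrE normrZ. Qed.
(** Positive elements of R[i] are real, hence the balls with real radius form a
    neighbourhood basis. *)
Lemma nbhs_nr x (A : set V) : nbhs x A <->
  exists2 e : R, 0 < e & forall y, nr (y - x) < e -> A y.
Proof.
rewrite -nbhs_ballE; split.
  move=> [e /= e0 xA]; have er : e = (complex.Re e)%:C by rewrite RRe_real // gtr0_real.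
  exists (complex.Re e); first by rewrite -ltcR -er.
  by move=> y ye; apply: xA; rewrite -ball_normE /= distrC nrE er ltcR.
move=> [e e0 xA]; exists e%:C; first by rewrite /= ltcR.
by move=> y; rewrite -ball_normE /= distrC nrE ltcR => /xA.
Qed.
End NormedModule.
Lemma nrM (a b : C) : nr (a * b) = nr a * nr b.
Proof. exact: nrZ. Qed.
Lemma nrX (a : C) n : nr (a ^+ n) = nr a ^+ n.
Proof. by apply: (@complexI R); rewrite rmorphXn /= -!nrE normrX. Qed.
Lemma nrV (a : C) : nr a^-1 = (nr a)^-1.
Proof. by apply: (@complexI R); rewrite fmorphV /= -!nrE normfV. Qed.
Lemma nr1 : nr (1 : C) = 1.
Proof. by rewrite unlock normr1. Qed.
Lemma nr_real (a : R) : nr (a%:C) = `|a|.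
Proof. by rewrite unlock normc_def /= expr0n /= addr0 sqrtr_sqr. Qed.
Lemma ReIm_nr (z : C) : nr z <= `|complex.Re z| + `|complex.Im z|.
Proof.
rewrite [z in nr z]complexE (le_trans (nrD _ _)) // nrM !nr_real.
by rewrite unlock normc_def /= expr0n expr1n add0r sqrtr1 mul1r.
Qed.
Lemma Re_nr (z : C) : `|complex.Re z| <= nr z.
Proof. by rewrite -lecR -nrE normc_ge_Re. Qed.
Lemma Im_nr (z : C) : `|complex.Im z| <= nr z.
Proof.
rewrite unlock normc_def /= -sqrtr_sqr ler_wsqrtr // lerDr sqr_ge0 //.
Qed.

Section Matrix.
Variables m n : nat.
Implicit Types x : 'M[C]_(m, n).
Lemma nr_coord x i j : nr (x i j) <= nr x.
Proof.
rewrite -lecR -!nrE {2}/Num.norm /=.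
have : mx_norm x <= mx_norm x by [].
rewrite {1}mx_normE [_ <= mx_norm _]num_le => /bigmax_leP[_ /(_ (i, j) isT)].
by rewrite -num_le.
Qed.
Lemma nr_le x (M : R) : 0 <= M -> (forall i j, nr (x i j) <= M) -> nr x <= M.
Proof.
move=> M0 H; rewrite -lecR -!nrE {1}/Num.norm /= mx_normE.
have M0' : 0 <= M%:C by rewrite ler0c.
rewrite -[leRHS]/(NngNum M0')%:num num_le; apply/bigmax_leP; split => //.
by move=> [i j] _; rewrite -num_le /= nrE lecR.
Qed.
Lemma nr_lt x (M : R) : 0 < M -> (forall i j, nr (x i j) < M) -> nr x < M.
Proof.
move=> M0 H; have [/eqP|x0] := eqVneq (nr x) 0; first by move=> /eqP ->.
have [|[i j] /= ij] := @mx_norm_neq0 _ _ _ x.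
  by apply: contra_neq x0 => h; apply/eqP; rewrite nr_eq0 -normr_eq0 /Num.norm /= h.
by have : nr x = nr (x i j); [apply: (@complexI R); rewrite -!nrE|move=> ->].
Qed.
End Matrix.
End Norm.

(** * Limits and inverses of differentiable maps *)

Section Differentiability.
Context {R : realType}.
Local Notation C := R[i].
Variables V W : normedModType C.

(** The epsilon-delta form of complex differentiability, used to prove that
    limits and inverse maps are differentiable. *)
Lemma differentiable_nrP (f : V -> W) x : differentiable f x <->
  exists2 L : {linear V -> W}, (exists K : R, forall h, nr (L h) <= K * nr h) &
  forall e : R, 0 < e -> exists2 d : R, 0 < d &
  forall y, nr (y - x) < d -> nr (f y - f x - L (y - x)) <= e * nr (y - x).
Proof.
split.
  move=> /diff_locallyP[dfc /eqaddoP dfo]; exists ('d f x).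
    have [k k0 kP] := linear_lipschitz dfc.
    exists (complex.Re k) => h; rewrite -lecR rmorphM /= -!nrE.
    by rewrite RRe_real ?gtr0_real.
  move=> e e0; have e0' : (0 : C) < e%:C by rewrite ltcR.
  have /nbhs_nr[d d0 dP] := dfo _ e0'.
  exists d => // y yx; have := dP (y - x).
  rewrite subr0 => /(_ yx) /=.
  by rewrite !nrE -rmorphM lecR !fctE /= subrK opprD addrA.
move=> [L [K KP] LP].
have Lc : continuous L.
  move=> z A /nbhs_nr[e e0 eA]; apply/nbhs_nr.
  have K0 : 0 < `|K| + 1 by rewrite ltr_wpDl.
  exists (e / (`|K| + 1)); first by rewrite divr_gt0.
  move=> y; rewrite ltr_pdivlMr // => yd; apply: eA.
  rewrite -linearB (le_lt_trans (KP _)) // (le_lt_trans _ yd) // mulrC.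
  by rewrite ler_wpM2l ?nr_ge0 // (le_trans (ler_norm K)) // lerDl.
have Lo : f \o shift x = cst (f x) + L +o_ 0 id.
  apply/eqaddoP => e e0; have er : e = (complex.Re e)%:C by rewrite RRe_real // gtr0_real.
  have e0' : 0 < complex.Re e by rewrite -ltcR -er.
  have [d d0 dP] := LP _ e0'.
  apply/nbhs_nr; exists d => // y; rewrite subr0 => yd.
  have := dP (y + x); rewrite addrK => /(_ yd) /=.
  by rewrite !nrE er -rmorphM lecR !fctE /= opprD addrA.
by apply/diff_locallyP; rewrite (diff_unique Lc Lo).
Qed.
End Differentiability.

Ltac vring := apply/matrixP => ? ?; rewrite !mxE; ring.

Section Limits.
Context {R : realType}.
Local Notation C := R[i].

(** The sequence u_t - 2 M / 2^t increases and u_t + 2 M / 2^t decreases, so the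
    supremum of the former lies between them. *)
Lemma geo_lim_real (u : nat -> R) (M : R) :
  (forall t, `|u t.+1 - u t| <= M * 2^-1 ^+ t) ->
  exists l, forall t, `|u t - l| <= 2 * M * 2^-1 ^+ t.
Proof.
move=> H; pose e t : R := 2 * M * 2^-1 ^+ t.
have eS t : e t.+1 = M * 2^-1 ^+ t by rewrite /e exprS; field.
have e2 t : e t = 2 * e t.+1 by rewrite eS /e; ring.
have M0 : 0 <= M by have := H 0; rewrite expr0 mulr1; apply: le_trans.
have e0 t : 0 <= e t by rewrite !mulr_ge0 // exprn_ge0 // invr_ge0.
have mono s t : u s - e s <= u (s + t)%N - e (s + t)%N /\
    u (s + t)%N + e (s + t)%N <= u s + e s.
  elim: t => [|t [IH1 IH2]]; first by rewrite addn0.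
  have := H (s + t)%N; have := e2 (s + t)%N; rewrite -eS addnS ler_norml.
  by move=> h0 /andP[h1 h2]; split; lra.
have bnd s t : u s - e s <= u t + e t.
  have [[h1 _] [_ h2]] := (mono s t, mono t s); have := e0 (s + t)%N.
  by rewrite addnC in h2; lra.
pose S := [set u t - e t | t in [set: nat]].
have S0 : S !=set0 by exists (u 0 - e 0); exists 0%N.
exists (sup S) => t; rewrite ler_distlC; apply/andP; split.
  apply: ub_le_sup; last by exists t.
  by exists (u 0 + e 0) => _ [s _ <-]; exact: bnd.
by apply: ge_sup => // _ [s _ <-]; exact: bnd.
Qed.

Lemma geo_lim m n (u : nat -> 'M[C]_(m, n)) (M : R) :
  (forall t, nr (u t.+1 - u t) <= M * 2^-1 ^+ t) ->
  exists l, forall t, nr (u t - l) <= 4 * M * 2^-1 ^+ t.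
Proof.
move=> H.
have M0 : 0 <= M by have := H 0; rewrite expr0 mulr1; apply: le_trans; exact: nr_ge0.
have lre i j : exists l, forall t,
    `|complex.Re (u t i j) - l| <= 2 * M * 2^-1 ^+ t.
  apply: geo_lim_real => t; apply: le_trans (H t).
  by apply: le_trans (nr_coord _ i j); rewrite -raddfB !mxE Re_nr.
have lim i j : exists l, forall t,
    `|complex.Im (u t i j) - l| <= 2 * M * 2^-1 ^+ t.
  apply: geo_lim_real => t; apply: le_trans (H t).
  by apply: le_trans (nr_coord _ i j); rewrite -raddfB !mxE Im_nr.
have [a aP] := choice (fun ij : 'I_m * 'I_n => lre ij.1 ij.2).
have [b bP] := choice (fun ij : 'I_m * 'I_n => lim ij.1 ij.2).
exists (\matrix_(i, j) (a (i, j) +i* b (i, j))) => t.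
apply: nr_le => [|i j]; first by rewrite !mulr_ge0 // exprn_ge0 // invr_ge0.
rewrite !mxE; apply: le_trans (ReIm_nr _) _.
have := aP (i, j) t; have := bP (i, j) t; rewrite !raddfB /=; lra.
Qed.

Lemma half_small (e : R) : 0 < e -> exists t, 2^-1 ^+ t < e.
Proof.
move=> e0; have := @near_infty_natSinv_expn_lt R (PosNum e0).
move=> [t _ /(_ t (leqnn _))] /=; rewrite div1r -exprVn => h.
by exists t.
Qed.

Lemma nr_sum (V : normedModType C) (I : Type) (r : seq I) (F : I -> V) :
  nr (\sum_(i <- r) F i) <= \sum_(i <- r) nr (F i).
Proof.
elim/big_rec2 : _ => [|i x y _ h]; first by rewrite nr0.
by rewrite (le_trans (nrD _ _)) // lerD2l.
Qed.

Lemma nr_mulmx k l (h : 'rV[C]_k) (M : 'M[C]_(k, l)) :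
  nr (h *m M) <= k%:R * nr M * nr h.
Proof.
apply: nr_le => [|i j]; first by rewrite !mulr_ge0 ?nr_ge0.
rewrite mxE (le_trans (nr_sum _ _)) //.
have -> : k%:R * nr M * nr h = \sum_(s < k) nr M * nr h.
  by rewrite sumr_const card_ord -mulrA mulr_natl.
apply: ler_sum => s _.
by rewrite nrM mulrC; apply: ler_pM; rewrite ?nr_ge0 ?nr_coord.
Qed.

Variable k : nat.
Local Notation E := 'rV[C]_k.

(** By homogeneity it is enough to compare the two sides on a small ball. *)
Lemma linear_nr_scale (L : {linear E -> E}) (a b d : R) : 0 < d ->
  (forall h, nr h < d -> a * nr h <= b * nr (L h)) ->
  forall h, a * nr h <= b * nr (L h).
Proof.
move=> d0 H h; have [/eqP|h0] := eqVneq (nr h) 0.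
  by rewrite nr_eq0 => /eqP ->; rewrite linear0 nr0 !mulr0.
have h1 : 0 < nr h by rewrite lt_def h0 nr_ge0.
pose s : R := d / (2 * nr h).
have s0 : 0 < s by rewrite divr_gt0 // mulr_gt0.
have := H (s%:C *: h); rewrite linearZ !nrZ nr_real gtr0_norm //=.
have -> : s * nr h = d / 2 by rewrite /s; field.
rewrite ltr_pdivrMr // ltr_pMr // ltr1n => /(_ isT).
have -> : d / 2 = s * nr h by rewrite /s; field.
by rewrite !(mulrCA _ s) ler_pM2l.
Qed.

Lemma linear_nr_scale_le (L : {linear E -> E}) (a d : R) : 0 < d ->
  (forall h, nr h < d -> nr (L h) <= a * nr h) ->
  forall h, nr (L h) <= a * nr h.
Proof.
move=> d0 H h.
have := @linear_nr_scale L (- a) (-1) d d0 _ h.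
rewrite !mulNr mul1r lerN2; apply => y /H; by rewrite !mulNr mul1r lerN2.
Qed.

Lemma nr_lin1_mx (L : {linear E -> E}) (a : R) : 0 <= a ->
  (forall h, nr (L h) <= a * nr h) -> nr (lin1_mx L) <= a.
Proof.
move=> a0 H; apply: nr_le => // i j; rewrite mxE.
apply: le_trans (nr_coord _ _ _) _; apply: le_trans (H _) _.
rewrite ler_piMr //; apply: nr_le => // s t; rewrite mxE.
by case: (_ && _); rewrite unlock ?normr1 ?normr0 //= ler01.
Qed.

(** Approximation is asked for the difference quotients at x.  The differentials
    of approximants with error 2^-t then form a Cauchy sequence of matrices,
    whose limit is the differential of f. *)
Lemma differentiable_lim (f : E -> E) x :
  (forall e : R, 0 < e -> exists g, differentiable g x /\
     exists2 d : R, 0 < d & forall y, nr (y - x) < d ->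
       nr ((f y - g y) - (f x - g x)) <= e * nr (y - x)) ->
  differentiable f x.
Proof.
move=> H.
have H1 t : exists L : {linear E -> E}, exists2 d : R, 0 < d &
    forall y, nr (y - x) < d ->
    nr (f y - f x - L (y - x)) <= 2^-1 ^+ t * nr (y - x).
  have e0 : 0 < (2^-1 : R) ^+ t / 2 by rewrite divr_gt0 // exprn_gt0 // invr_gt0.
  have [g [/differentiable_nrP[L _ LP] [d d0 dP]]] := H _ e0.
  have [d' d'0 d'P] := LP _ e0.
  exists L; exists (Num.min d d'); first by rewrite lt_min d0.
  move=> y; rewrite lt_min => /andP[/dP h1 /d'P h2].
  have -> : f y - f x - L (y - x) =
    ((f y - g y) - (f x - g x)) + (g y - g x - L (y - x)).
    by vring.
  apply: le_trans (nrD _ _) _; lra.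
have [L LP] := choice H1.
have key s t h : nr (L s h - L t h) <= (2^-1 ^+ s + 2^-1 ^+ t) * nr h.
  have [d d0 dP] := LP s; have [d' d'0 d'P] := LP t.
  apply: (@linear_nr_scale_le (L s \- L t) _ (Num.min d d')).
    by rewrite lt_min d0.
  move=> {}h; rewrite lt_min => /andP[hd hd'] /=.
  have := dP (h + x); have := d'P (h + x); rewrite addrK => /(_ hd') h1 /(_ hd) h2.
  have -> : L s h - L t h = (f (h + x) - f x - L t h) - (f (h + x) - f x - L s h).
    by vring.
  apply: le_trans (nrB _ _) _; lra.
have p0 t : 0 < (2^-1 : R) ^+ t by rewrite exprn_gt0 // invr_gt0.
have /geo_lim[M MP] t : nr (lin1_mx (L t.+1) - lin1_mx (L t)) <= 2 * 2^-1 ^+ t.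
  have -> : lin1_mx (L t.+1) - lin1_mx (L t) = lin1_mx (L t.+1 \- L t).
    by apply/matrixP => i j; rewrite !mxE.
  apply: nr_lin1_mx => [|h]; first by rewrite mulr_ge0 // ltW.
  apply: le_trans (key _ _ _) _; apply: ler_wpM2r (nr_ge0 _) _ _ _.
  by rewrite exprS; have := p0 t; lra.
apply/differentiable_nrP; exists (mulmxr M).
  by exists (k%:R * nr M) => h; exact: nr_mulmx.
move=> e e0; (* The matrices converge with error 8 / 2^t, which costs k * 8 / 2^t on vectors. *)
pose K : R := 1 + k%:R * 8.
have K0 : 0 < K by rewrite ltr_pwDl // mulr_ge0.
have [t tP] := half_small (divr_gt0 e0 K0).
have [d d0 dP] := LP t; exists d => // y /dP h1.
have -> : f y - f x - mulmxr M (y - x) =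
   (f y - f x - L t (y - x)) + (y - x) *m (lin1_mx (L t) - M).
  by rewrite /= mulmxBr mul_rV_lin1 /= addrA subrK.
apply: le_trans (nrD _ _) _.
have h5 := nr_mulmx (y - x) (lin1_mx (L t) - M).
have h3 := MP t; rewrite ltr_pdivlMr // in tP.
have h4 := ler_wpM2l (ler0n R k) h3.
have a0 := nr_ge0 (y - x); set a := nr (y - x) in h1 h5 a0 *.
have {}h5 := le_trans h5 (ler_wpM2r a0 h4).
apply: le_trans (lerD h1 h5) _; rewrite -mulrDl ler_wpM2r //.
by rewrite /K in tP; lra.
Qed.

(** A Lipschitz inverse makes the differential of f injective, hence invertible
    as the dimension is finite; the first order expansion of f can then be
    solved for the increment of g. *)
Lemma differentiable_inv (f g : E -> E) x (K : R) :
  differentiable f x ->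
  (\forall y \near x, g (f y) = y) ->
  (\forall v \near f x, f (g v) = v) ->
  (\forall v \near f x, nr (g v - x) <= K * nr (v - f x)) ->
  differentiable g (f x).
Proof.
move=> df gf fg gK.
have [L [N LN] LP] := (differentiable_nrP _ _).1 df.
have fK : \forall y \near x, nr (y - x) <= K * nr (f y - f x).
  have h : \forall y \near x, nr (g (f y) - x) <= K * nr (f y - f x).
    exact: (differentiable_continuous df gK).
  near=> y; have gy : g (f y) = y by near: y.
  by rewrite -{1}gy; near: y.
have K10 : 0 < `|K| + 1 by rewrite ltr_wpDl.
have KK : K <= `|K| + 1 by rewrite (le_trans (ler_norm _)) // lerDl.
set K1 := `|K| + 1 in K10 KK.
have low h : nr h <= 2 * K1 * nr (L h).
  have [|d d0 dP] := LP (2 * K1)^-1; first by rewrite invr_gt0 mulr_gt0.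
  have [d' d'0 d'P] := (nbhs_nr _ _).1 fK.
  rewrite -[leLHS]mul1r.
  apply: (@linear_nr_scale L _ _ (Num.min d d')); first by rewrite lt_min d0.
  move=> {}h; rewrite lt_min => /andP[hd hd'].
  have := dP (h + x); have := d'P (h + x); rewrite addrK /= => /(_ hd') h1 /(_ hd) h2.
  have h3 : nr (f (h + x) - f x) <= (2 * K1)^-1 * nr h + nr (L h).
    by apply: le_trans (lerD h2 (lexx _)); rewrite -{1}(subrK (L h) (f _ - f x)) nrD.
  have := le_trans h1 (ler_wpM2r (nr_ge0 _) KK).
  move=> /le_trans/(_ (ler_wpM2l (ltW K10) h3)).
  have -> : K1 * ((2 * K1)^-1 * nr h + nr (L h)) = nr h / 2 + K1 * nr (L h).
    by field; rewrite lt0r_neq0.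
  lra.
have Mu : lin1_mx L \in unitmx.
  rewrite -row_free_unit; apply: inj_row_free => v; rewrite mul_rV_lin1 /= => v0.
  have := low v; rewrite v0 nr0 mulr0 => h; apply/eqP; rewrite -nr_eq0.
  by rewrite eq_le h nr_ge0.
have LK z : L (z *m invmx (lin1_mx L)) = z.
  by rewrite -mul_rV_lin1 mulmxKV.
have L'K h : (L h) *m invmx (lin1_mx L) = h by rewrite -mul_rV_lin1 mulmxK.
have gx : g (f x) = x by exact: (nbhs_singleton gf).
apply/differentiable_nrP; exists (mulmxr (invmx (lin1_mx L))).
  by exists (2 * K1) => h /=; rewrite -{2}[h]LK low.
move=> e e0; have e1 : 0 < e / (2 * K1 * K1) by rewrite divr_gt0 // !mulr_gt0.
have [d d0 dP] := LP _ e1.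
have [d1 d10 d1P] := (nbhs_nr _ _).1 fg; have [d2 d20 d2P] := (nbhs_nr _ _).1 gK.
exists (Num.min (Num.min d1 d2) (d / K1)); first by rewrite !lt_min d10 d20 divr_gt0.
move=> v; rewrite !lt_min => /andP[/andP[/d1P v1 /d2P v2] v3].
have v4 := le_trans v2 (ler_wpM2r (nr_ge0 _) KK).
have /dP : nr (g v - x) < d.
  by apply: le_lt_trans v4 _; rewrite mulrC -ltr_pdivlMr.
rewrite v1 gx /= => h.
have -> : g v - x - (v - f x) *m invmx (lin1_mx L) =
   - ((v - f x - L (g v - x)) *m invmx (lin1_mx L)).
  by rewrite [in RHS]mulmxBl L'K opprB.
rewrite nrN; apply: le_trans (low _) _; rewrite LK.
apply: le_trans (ler_wpM2l _ h) _; first by rewrite mulr_ge0 // ltW.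
apply: le_trans (ler_wpM2l _ (ler_wpM2l (ltW e1) v4)) _.
  by rewrite mulr_ge0 // ltW.
by rewrite le_eqVlt; apply/orP; left; apply/eqP; field; rewrite lt0r_neq0.
Unshelve. all: by end_near. Qed.

End Limits.

(** * Basins of non-autonomous contractions *)

Section Zmod.
Variable V : zmodType.
Implicit Types u v w a b g h y : V.
Lemma subr_mid v u w : u - w = (u - v) + (v - w).
Proof. by rewrite addrA subrK. Qed.
Lemma subrACA u v w y : u - v - (w - y) = u - w - (v - y).
Proof. by rewrite !opprB addrACA [RHS]addrACA [- v + _]addrC [- w + _]addrC. Qed.
End Zmod.

(** The relative increments of D are summable with a sum so small that D stays
    within a fourth of its initial norm from its initial value.  Below, D t is
    the difference of the values at two points of the t-th rescaled map: these
    bounds make the limit map bi-Lipschitz. *)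
Section Drift.
Context {R : realType} (V : normedModType R[i]) (D : nat -> V).
Hypothesis DP : forall t, nr (D t.+1 - D t) <= 2^-1 ^+ t / 10 * nr (D t).
Let d := nr (D 0).
Let p0 t : 0 < (2^-1 : R) ^+ t.
Proof. by rewrite exprn_gt0 // invr_gt0. Qed.
Let pS t : (2^-1 : R) ^+ t.+1 = 2^-1 ^+ t / 2.
Proof. by rewrite exprS mulrC. Qed.

Lemma drift_far t : nr (D t - D 0) <= (1 - 2^-1 ^+ t) / 4 * d.
Proof.
have d0 : 0 <= d := nr_ge0 _.
elim: t => [|t IH]; first by rewrite subrr nr0 expr0 subrr !mul0r.
have h1 := DP t.
rewrite (subr_mid (D t)).
apply: le_trans (nrD _ _) _.
have h2 : nr (D t) <= d * (5 / 4).
  rewrite -(subrK (D 0) (D t)); apply: le_trans (nrD _ _) _; rewrite -/d.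
  have : 2^-1 ^+ t * d >= 0 by rewrite mulr_ge0 // ltW.
  lra.
have p10 : 0 <= (2^-1 : R) ^+ t / 10 by rewrite divr_ge0 // ltW.
have h3 := ler_wpM2l p10 h2.
have -> : (1 - 2^-1 ^+ t.+1) / 4 * d = (1 - 2^-1 ^+ t) / 4 * d + 2^-1 ^+ t / 8 * d.
  by rewrite pS; field.
apply: le_trans (lerD h1 IH) _; lra.
Qed.

Lemma drift_step t : nr (D t.+1 - D t) <= 2^-1 ^+ t / 8 * d.
Proof.
have d0 : 0 <= d := nr_ge0 _.
have h1 := DP t.
have h2 : nr (D t) <= d * (5 / 4).
  rewrite -(subrK (D 0) (D t)); apply: le_trans (nrD _ _) _; rewrite -/d.
  have : 2^-1 ^+ t * d >= 0 by rewrite mulr_ge0 // ltW.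
  have := drift_far t; lra.
have p10 : 0 <= (2^-1 : R) ^+ t / 10 by rewrite divr_ge0 // ltW.
have h3 := ler_wpM2l p10 h2; lra.
Qed.

Lemma drift_tail t s : nr (D (t + s)%N - D t) <= 2^-1 ^+ t / 4 * d.
Proof.
have d0 : 0 <= d := nr_ge0 _.
suff : nr (D (t + s)%N - D t) <= (2^-1 ^+ t - 2^-1 ^+ (t + s)) / 4 * d.
  move=> /le_trans; apply; apply: ler_wpM2r => //.
  by have := p0 (t + s); lra.
elim: s => [|s IH]; first by rewrite addn0 !subrr nr0 !mul0r.
rewrite addnS; have := drift_step (t + s).
move=> h; rewrite (subr_mid (D (t + s)%N)).
apply: le_trans (nrD _ _) _; apply: le_trans (lerD h IH) _.
by rewrite pS; lra.
Qed.
End Drift.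

Section Auto.
Context {R : realType} {k : nat}.
Local Notation C := R[i].
Local Notation E := 'rV[C]_k.

Lemma differentiable_lip (f : E -> E) x : differentiable f x ->
  exists2 K : R, 0 < K & \forall y \near x, nr (f y - f x) <= K * nr (y - x).
Proof.
move=> /differentiable_nrP[L [K LK] LP].
have [d d0 dP] := LP 1 ltr01; exists (`|K| + 1); first by rewrite ltr_wpDl.
apply/nbhs_nr; exists d => // y /dP h.
rewrite -(subrK (L (y - x)) (f y - f x)) (le_trans (nrD _ _)) //.
rewrite mulrDl addrC lerD // (le_trans (LK _)) // ler_wpM2r ?nr_ge0 //.
exact: ler_norm.
Qed.

Lemma differentiable_affine (a b : E) (u : C) x :
  differentiable (fun z : E => u *: (z - a) + b) x.
Proof.
have -> : (fun z : E => u *: (z - a) + b) = u *: (id - cst a) + cst b by [].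
apply: differentiableD => //; apply: differentiableZ; exact: differentiableB.
Qed.

(** The inverse and its differentiability are data, so that they pass to
    compositions. *)
Record auto := Auto {
  af :> E -> E;
  ag : E -> E;
  afK : cancel af ag;
  agK : cancel ag af;
  afd : forall x, differentiable af x;
  agd : forall x, differentiable ag x }.

Lemma differentiable_idfun (x : E) : differentiable (@id E) x.
Proof. by []. Qed.
Definition auto_id : auto :=
  @Auto id id (fun=> erefl) (fun=> erefl)
    differentiable_idfun differentiable_idfun.
Definition auto_comp (f g : auto) : auto :=
  @Auto (f \o g) (ag g \o ag f) (can_comp (afK f) (afK g))
    (can_comp (agK g) (agK f))
    (fun x => differentiable_comp (afd g x) (afd f (g x)))
    (fun x => differentiable_comp (agd f x) (agd g (ag f x))).

(** The space is the union of the segments from the origin. *)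
Lemma connected_rV : connected [set: E].
Proof.
have -> : [set: E] = \bigcup_(v in [set: E]) ((fun t : R => t%:C *: v) @` `[0, 1]).
  apply/seteqP; split => // v _; exists v => //; exists 1; last by rewrite scale1r.
  by rewrite /= in_itv /= ler01 lexx.
apply: bigcup_connected.
  by exists 0 => v _; exists 0; rewrite ?scale0r //= in_itv /= lexx ler01.
move=> v _; apply: connected_continuous_connected; first exact: segment_connected.
apply: continuous_subspaceT => t A /nbhs_nr[e e0 eA].
apply/nbhs_ballP; exists (e / (nr v + 1)); first by rewrite /= divr_gt0 // ltr_wpDl ?nr_ge0.
move=> s; rewrite -ball_normE /= ltr_pdivlMr ?ltr_wpDl ?nr_ge0 // => h; apply: eA.
rewrite -scalerBl nrZ -rmorphB nr_real distrC; apply: le_lt_trans h.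
by rewrite ler_wpM2l // lerDl.
Qed.
End Auto.
Arguments auto : clear implicits.

(** The hypotheses on [psi] say that near the fixed point a all the maps of the
    system are c times the identity, up to an error with Lipschitz constant at
    most [K * rho] on the ball of radius rho.  It is this linear decay in rho
    that makes the relative errors along an orbit summable. *)
Section Basin.
Context {R : realType} {k : nat}.
Local Notation C := R[i].
Local Notation E := 'rV[C]_k.
Variables (a : E) (r c K : R) (Phi : nat -> auto R k) (psi : nat -> E -> E).
Hypotheses (r0 : 0 < r) (c0 : 0 < c) (c4 : c <= 1/4) (K0 : 0 <= K).
Hypothesis Kr : K * r <= c / 10.
Hypothesis PhiS : forall n z, Phi n.+1 z = psi n (Phi n z).
Hypothesis Phia : forall n, Phi n a = a.
Hypothesis psiP : forall n rho x y, rho <= r ->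
  nr (x - a) <= rho -> nr (y - a) <= rho ->
  nr (psi n x - psi n y - c%:C *: (x - y)) <= K * rho * nr (x - y).

Definition basin := [set z | exists N, nr (Phi N z - a) < r].

Let p0 t : 0 < (2^-1 : R) ^+ t.
Proof. by rewrite exprn_gt0 // invr_gt0. Qed.
Let p1 t : (2^-1 : R) ^+ t <= 1.
Proof. by rewrite exprn_ile1 // ?invr_ge0 // invf_le1 // ler1n. Qed.
Let pS t : (2^-1 : R) ^+ t.+1 = 2^-1 ^+ t / 2.
Proof. by rewrite exprS mulrC. Qed.

(** The Lipschitz constant of the maps on the ball of radius r is at most
    c + K r, which is less than a half. *)
Lemma trap_half N z rho : rho <= r -> nr (Phi N z - a) <= rho ->
  nr (Phi N.+1 z - a) <= rho / 2.
Proof.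
move=> rr h; have rho0 : 0 <= rho by apply: le_trans h; exact: nr_ge0.
have psia : psi N a = a by rewrite -{1}(Phia N) -PhiS Phia.
have := @psiP N rho (Phi N z) a rr h.
rewrite subrr nr0 => /(_ rho0) h1; rewrite PhiS -[a in psi _ _ - a]psia.
rewrite -(subrK (c%:C *: (Phi N z - a)) (psi _ _ - _)).
apply: le_trans (nrD _ _) _; rewrite nrZ nr_real gtr0_norm //.
have h2 : K * rho <= c / 10 by apply: le_trans Kr; exact: ler_wpM2l.
have h3 := ler_wpM2r (nr_ge0 (Phi N z - a)) h2.
have h4 := ler_wpM2r (nr_ge0 (Phi N z - a)) c4.
lra.
Qed.

Lemma trap_decay N z t : nr (Phi N z - a) < r ->
  nr (Phi (N + t)%N z - a) <= 2^-1 ^+ t * r.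
Proof.
move=> /ltW h; elim: t => [|t IH]; first by rewrite addn0 expr0 mul1r.
rewrite addnS pS mulrAC; apply: trap_half IH.
by rewrite ler_piMl // ltW.
Qed.

Lemma trapW N M z : (N <= M)%N -> nr (Phi N z - a) < r ->
  nr (Phi M z - a) < r.
Proof.
move=> /subnKC <- h; case: (M - N)%N => [|t]; first by rewrite addn0.
apply: le_lt_trans (trap_decay _ h) _; rewrite pS.
by rewrite gtr_pMl //; have := p1 t; lra.
Qed.

Definition blowup n z : E := ((c^-1) ^+ n)%:C *: (Phi n z - a).

Lemma blowupE n z : blowup n z = ((c^-1) ^+ n)%:C *: (Phi n z - a). Proof. by []. Qed.
Lemma blowupB n x y : blowup n x - blowup n y = ((c^-1) ^+ n)%:C *: (Phi n x - Phi n y).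
Proof. by rewrite /blowup; vring. Qed.
Lemma blowup_fixed n : blowup n a = 0. Proof. by rewrite /blowup Phia subrr scaler0. Qed.
Lemma nr_blowupB n x y : nr (blowup n x - blowup n y) = (c^-1) ^+ n * nr (Phi n x - Phi n y).
Proof. by rewrite blowupB nrZ nr_real ger0_norm // exprn_ge0 // invr_ge0 ltW. Qed.

Opaque blowup.

(** At time N + t both points are within r / 2^t of a, where the map differs from
    c times the identity by an error with Lipschitz constant K r / 2^t; dividing
    by c gives a relative error of at most 2^-t / 10. *)
Lemma blowup_step N t x y : nr (Phi N x - a) < r -> nr (Phi N y - a) < r ->
  nr ((blowup (N + t).+1 x - blowup (N + t).+1 y) - (blowup (N + t) x - blowup (N + t) y)) <=
  2^-1 ^+ t / 10 * nr (blowup (N + t) x - blowup (N + t) y).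
Proof.
move=> hx hy; set n := (N + t)%N.
have hr : 2^-1 ^+ t * r <= r by rewrite ler_piMl // ltW.
have := psiP n hr (trap_decay t hx) (trap_decay t hy); rewrite -/n -!PhiS => h.
have c00 : c != 0 by rewrite lt0r_neq0.
have -> : (blowup n.+1 x - blowup n.+1 y) - (blowup n x - blowup n y) =
   ((c^-1) ^+ n.+1)%:C *: (Phi n.+1 x - Phi n.+1 y - c%:C *: (Phi n x - Phi n y)).
  have e : (c^-1 ^+ n.+1)%:C * c%:C = (c^-1 ^+ n)%:C :> C.
    by rewrite -rmorphM /= exprSr -mulrA mulVf // mulr1.
  by rewrite scalerBr scalerA e -!blowupB.
have ci : 0 < (c^-1) ^+ n by rewrite exprn_gt0 // invr_gt0.
rewrite (nr_blowupB n x y) nrZ nr_real.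
rewrite ger0_norm; last by rewrite exprn_ge0 // invr_ge0 ltW.
rewrite exprSr.
apply: le_trans (ler_wpM2l _ h) _; first by rewrite mulr_ge0 // ?invr_ge0 // ltW.
have -> : c^-1 ^+ n / c * (K * (2^-1 ^+ t * r) * nr (Phi n x - Phi n y)) =
  (K * r) * (c^-1 ^+ n / c * 2^-1 ^+ t * nr (Phi n x - Phi n y)) by ring.
have -> : 2^-1 ^+ t / 10 * (c^-1 ^+ n * nr (Phi n x - Phi n y)) =
  (c / 10) * (c^-1 ^+ n / c * 2^-1 ^+ t * nr (Phi n x - Phi n y)) by field.
apply: ler_wpM2r => //.
by rewrite !mulr_ge0 ?nr_ge0 ?invr_ge0 // ltW.
Qed.

Lemma blowup_drift_step N t x y : nr (Phi N x - a) < r -> nr (Phi N y - a) < r ->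
  nr ((blowup (N + t.+1) x - blowup (N + t.+1) y) - (blowup (N + t) x - blowup (N + t) y)) <=
  2^-1 ^+ t / 8 * nr (blowup N x - blowup N y).
Proof.
move=> hx hy; have := @drift_step R E (fun t => blowup (N + t) x - blowup (N + t) y) _ t.
rewrite addn0; apply=> s; rewrite addnS; exact: blowup_step.
Qed.

Lemma blowup_drift_tail N t s x y : nr (Phi N x - a) < r -> nr (Phi N y - a) < r ->
  nr ((blowup (N + (t + s)) x - blowup (N + (t + s)) y) - (blowup (N + t) x - blowup (N + t) y)) <=
  2^-1 ^+ t / 4 * nr (blowup N x - blowup N y).
Proof.
move=> hx hy; have := @drift_tail R E (fun t => blowup (N + t) x - blowup (N + t) y) _ t s.
rewrite addn0; apply=> u; rewrite addnS; exact: blowup_step.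
Qed.

Lemma blowup_lim_ex z : exists l, basin z ->
  forall e, 0 < e -> exists n0, forall n, (n0 <= n)%N -> nr (blowup n z - l) < e.
Proof.
have [[N zN]|nz] := pselect (basin z); last by exists 0.
have aN : nr (Phi N a - a) < r by rewrite Phia subrr nr0.
have [t|l lP] := @geo_lim R 1 k (fun t => blowup (N + t) z) (nr (blowup N z) / 8).
  have := blowup_drift_step t zN aN; rewrite !blowup_fixed !subr0 => /le_trans; apply; lra.
exists l => _ e e0.
have M0 : 0 <= 4 * (nr (blowup N z) / 8) by rewrite mulr_ge0 // divr_ge0 ?nr_ge0.
have [|t tP] := @half_small R (e / (4 * (nr (blowup N z) / 8) + 1)).
  by rewrite divr_gt0 // ltr_wpDl.
exists (N + t)%N => n Nn; have -> : n = (N + (t + (n - (N + t))))%N by rewrite addnA subnKC.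
apply: le_lt_trans (lP _) _; rewrite exprD.
rewrite ltr_pdivlMr ?ltr_wpDl // in tP; apply: le_lt_trans tP.
rewrite mulrDr mulr1 mulrC; set s := (n - _)%N.
have h := p1 s; have h1 := p0 t.
have h2 : 2^-1 ^+ t * 2^-1 ^+ s <= 2^-1 ^+ t :> R by rewrite ler_piMr // ltW.
have := ler_wpM2r M0 h2; lra.
Qed.

Definition blowup_lim : E -> E := projT1 (choice blowup_lim_ex).
Lemma blowup_limP z : basin z ->
  forall e, 0 < e -> exists n0, forall n, (n0 <= n)%N -> nr (blowup n z - blowup_lim z) < e.
Proof. exact: (projT2 (choice blowup_lim_ex)). Qed.

Opaque blowup_lim.

(** Let s go to infinity in [blowup_drift_tail]. *)
Lemma blowup_lim_near N x y t : nr (Phi N x - a) < r -> nr (Phi N y - a) < r ->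
  nr ((blowup_lim x - blowup_lim y) - (blowup (N + t) x - blowup (N + t) y)) <=
  2^-1 ^+ t / 4 * nr (blowup N x - blowup N y).
Proof.
move=> hx hy; apply/ler_addgt0Pr => e e0.
have bx : basin x by exists N.
have by' : basin y by exists N.
have e2 : 0 < e / 2 by rewrite divr_gt0.
have [n1 n1P] := blowup_limP bx e2; have [n2 n2P] := blowup_limP by' e2.
pose s := (n1 + n2)%N.
have h1 : (n1 <= N + (t + s))%N by rewrite /s addnA -addnCA leq_addr.
have h2 : (n2 <= N + (t + s))%N by rewrite /s !addnA leq_addl.
have h3 := blowup_drift_tail t s hx hy; set n := (N + (t + s))%N in h1 h2 h3.
have h4 : nr (blowup_lim x - blowup n x) < e / 2 by rewrite nrBC; exact: n1P.
have h5 : nr (blowup_lim y - blowup n y) < e / 2 by rewrite nrBC; exact: n2P.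
have h6 := nrB (blowup_lim x - blowup n x) (blowup_lim y - blowup n y).
rewrite (subr_mid (blowup n x - blowup n y)) [X in X + _]subrACA.
apply: le_trans (nrD _ _) _.
apply: le_trans (lerD (le_trans h6 (lerD (ltW h4) (ltW h5))) h3) _.
by rewrite -splitr addrC.
Qed.

Lemma basin_fixed : basin a.
Proof. by exists 0%N; rewrite Phia subrr nr0. Qed.
Lemma blowup_lim_fixed : blowup_lim a = 0.
Proof.
apply/eqP; rewrite -nr_eq0 eq_le nr_ge0 andbT; apply/ler_addgt0Pr => e e0.
have [n0 /(_ _ (leqnn _))] := blowup_limP basin_fixed e0.
by rewrite blowup_fixed sub0r nrN add0r => /ltW.
Qed.

Lemma blowup_lim_near0 N x y : nr (Phi N x - a) < r -> nr (Phi N y - a) < r ->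
  nr ((blowup_lim x - blowup_lim y) - (blowup N x - blowup N y)) <= nr (blowup N x - blowup N y) / 4.
Proof.
move=> hx hy; have := blowup_lim_near 0 hx hy.
by rewrite addn0 expr0 mul1r [_^-1 * _]mulrC.
Qed.

Lemma blowup_lim_inj x y : basin x -> basin y -> blowup_lim x = blowup_lim y -> x = y.
Proof.
move=> [N1 h1] [N2 h2] xy; pose N := maxn N1 N2.
have hx : nr (Phi N x - a) < r by apply: trapW h1; rewrite leq_maxl.
have hy : nr (Phi N y - a) < r by apply: trapW h2; rewrite leq_maxr.
have := blowup_lim_near0 hx hy; rewrite xy subrr sub0r nrN nr_blowupB => h.
have d0 : 0 < c^-1 ^+ N by rewrite exprn_gt0 // invr_gt0.
have h0 : nr (Phi N x - Phi N y) = 0.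
  apply/eqP; rewrite eq_le nr_ge0 andbT -(ler_pM2l d0) mulr0; lra.
apply: (can_inj (afK (Phi N))); apply/eqP.
by rewrite -subr_eq0 -nr_eq0 h0.
Qed.

(** The inverse of the rescaled map at time N; in the coordinates that it gives,
    the limit map is a perturbation of the identity. *)
Definition blowdown N (y : E) : E := ag (Phi N) ((c ^+ N)%:C *: y + a).
Lemma blowdownK N y : blowup N (blowdown N y) = y.
Proof.
rewrite blowupE /blowdown agK addrK scalerA -rmorphM -exprMn mulVf ?lt0r_neq0 //.
by rewrite expr1n scale1r.
Qed.
Lemma blowupK N x : blowdown N (blowup N x) = x.
Proof.
rewrite blowupE /blowdown scalerA -rmorphM -exprMn mulfV ?lt0r_neq0 //.
by rewrite expr1n scale1r subrK afK.
Qed.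
Lemma trap_blowdown N y : (nr (Phi N (blowdown N y) - a) < r) = (nr y < c^-1 ^+ N * r).
Proof.
rewrite /blowdown agK addrK nrZ nr_real ger0_norm ?exprn_ge0 ?ltW //.
by rewrite -[RHS](ltr_pM2l (exprn_gt0 N c0)) mulrA -exprMn mulfV ?lt0r_neq0 // expr1n mul1r.
Qed.
Lemma blowdown0 N : blowdown N 0 = a.
Proof. by rewrite /blowdown scaler0 add0r -[X in ag _ X](Phia N) afK. Qed.

(** In the coordinates of [blowdown N] the limit map is h = id + e, where e is
    1/4-Lipschitz on the ball of radius c^-N r and e(0) = 0; the iteration
    y := v - e(y) therefore stays in the ball of radius 2 |v| and converges. *)
Lemma blowup_lim_surj N v : 2 * nr v < c^-1 ^+ N * r ->
  exists2 x, nr (Phi N x - a) < r & blowup_lim x = v.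
Proof.
move=> hv; pose h y := blowup_lim (blowdown N y).
have hP y y' : nr y <= 2 * nr v -> nr y' <= 2 * nr v ->
    nr ((h y - h y') - (y - y')) <= nr (y - y') / 4.
  move=> h1 h2; rewrite -{2 3}[y](blowdownK N) -{2 3}[y'](blowdownK N).
  by apply: blowup_lim_near0; rewrite trap_blowdown; apply: le_lt_trans hv.
have v0 : 0 <= nr v := nr_ge0 _.
have h0 : h 0 = 0 by rewrite /h blowdown0 blowup_lim_fixed.
pose y t := iter t (fun y => v - (h y - y)) 0.
have yS t : y t.+1 = v - (h (y t) - y t) by [].
have yb t : nr (y t) <= 2 * nr v.
  elim: t => [|t IH]; first by rewrite nr0 mulr_ge0.
  have := hP _ 0 IH; rewrite nr0 mulr_ge0 // h0 !subr0 => /(_ isT) h1.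
  rewrite yS; apply: le_trans (nrB _ _) _; lra.
have ystep t : nr (y t.+1 - y t) <= nr v * 2^-1 ^+ t.
  elim: t => [|t IH].
    by rewrite yS /y /= h0 !subr0 expr0 mulr1.
  have := hP _ _ (yb t.+1) (yb t).
  have -> : y t.+2 - y t.+1 = - ((h (y t.+1) - h (y t)) - (y t.+1 - y t)).
    have gen (u b b' d d' : E) :
      (u - (b - b')) - (u - (d - d')) = - ((b - d) - (b' - d')) by vring.
    exact: gen.
  rewrite nrN pS; have := mulr_ge0 v0 (ltW (p0 t)); lra.
have [l lP] := geo_lim ystep.
have lb : nr l <= 2 * nr v.
  apply/ler_addgt0Pr => e e0.
  have [|t tP] := @half_small R (e / (4 * nr v + 1)).
    by rewrite divr_gt0 // ltr_wpDl // mulr_ge0.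
  rewrite ltr_pdivlMr ?ltr_wpDl ?mulr_ge0 // in tP.
  have := lP t; have := yb t; have := nrB (y t) (y t - l); have := p0 t.
  by rewrite opprB addrCA subrr addr0; lra.
exists (blowdown N l); first by rewrite trap_blowdown; apply: le_lt_trans hv.
rewrite -/(h l); apply/eqP; rewrite -subr_eq0 -nr_eq0 eq_le nr_ge0 andbT.
apply/ler_addgt0Pr => e e0; rewrite add0r.
have [|t tP] := @half_small R (e / (8 * nr v + 1)).
  by rewrite divr_gt0 // ltr_wpDl // mulr_ge0.
rewrite ltr_pdivlMr ?ltr_wpDl ?mulr_ge0 // in tP.
have := hP _ _ (yb t) lb; have := lP t; have := lP t.+1; rewrite pS.
have -> : h l - v = - ((h (y t) - h l) - (y t - l)) - (y t.+1 - l).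
  have gen (b d u p q : E) : b - u = - ((d - b) - (p - q)) - (u - (d - p) - q).
    by vring.
  by rewrite yS; exact: gen.
have := nrB (- ((h (y t) - h l) - (y t - l))) (y t.+1 - l); rewrite nrN.
have := p0 t; lra.
Qed.

Lemma blowup_radius_unbounded (M : R) : exists N, M < c^-1 ^+ N * r.
Proof.
have M0 : 0 < `|M| + 1 by rewrite ltr_wpDl.
have [t tP] := @half_small R (r / (`|M| + 1)) (divr_gt0 r0 M0).
exists t; apply: le_lt_trans (ler_norm _) _.
have h2 : 2 ^+ t <= c^-1 ^+ t.
  apply: lerXn2r; rewrite ?nnegrE ?invr_ge0 ?ltW //.
  rewrite -[c^-1]mulr1 ltr_pdivlMl //; have := c4; lra.
apply: lt_le_trans (ler_wpM2r (ltW r0) h2).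
move: tP; rewrite ltr_pdivlMr // exprVn mulrC ltr_pdivrMr ?exprn_gt0 //.
by rewrite mulrC; apply: lt_trans; rewrite ltrDl.
Qed.

Lemma basin_trap z : basin z -> forall M, exists N, [/\ nr (Phi N z - a) < r & M < c^-1 ^+ N * r].
Proof.
move=> [N1 h1] M; have [N2 h2] := blowup_radius_unbounded M.
exists (maxn N1 N2); split; first by apply: trapW h1; rewrite leq_maxl.
apply: lt_le_trans h2 _; apply: ler_wpM2r; first exact: ltW.
apply: ler_weXn2l; last by rewrite leq_maxr.
by rewrite invf_ge1 //; have := c4; lra.
Qed.

Lemma trap_near N x : nr (Phi N x - a) < r -> \forall y \near x, nr (Phi N y - a) < r.
Proof.
move=> hx; have h := differentiable_continuous (afd (Phi N) x).
apply: (h [set w | nr (w - a) < r]); apply/nbhs_nr; exists (r - nr (Phi N x - a)); first by rewrite subr_gt0.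
move=> y hy /=; rewrite (subr_mid (Phi N x)).
by apply: le_lt_trans (nrD _ _) _; lra.
Qed.

Lemma basin_open : open basin.
Proof.
rewrite openE => x [N hx]; have := trap_near hx; rewrite /interior /=.
by apply: filterS => y hy; exists N.
Qed.

Lemma blowup_diff N x : differentiable (blowup N) x.
Proof.
have -> : blowup N = (fun z : E => ((c^-1) ^+ N)%:C *: (z - a) + 0) \o Phi N.
  by apply/funext => z /=; rewrite blowupE addr0.
by apply: differentiable_comp; [exact: afd|exact: differentiable_affine].
Qed.
Lemma blowdown_diff N x : differentiable (blowdown N) x.
Proof.
have -> : blowdown N = ag (Phi N) \o (fun z : E => (c ^+ N)%:C *: (z - 0) + a).
  by apply/funext => z /=; rewrite subr0.
by apply: differentiable_comp; [exact: differentiable_affine|exact: agd].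
Qed.

(** By [blowup_lim_near], the rescaled maps at later and later times approximate
    the limit map as [differentiable_lim] requires. *)
Lemma blowup_lim_diff x : basin x -> differentiable blowup_lim x.
Proof.
move=> [N hx]; apply: differentiable_lim => e e0.
have [L L0 LP] := differentiable_lip (blowup_diff N x).
have [t tP] := half_small (divr_gt0 e0 L0).
exists (blowup (N + t)); split; first exact: blowup_diff.
apply/nbhs_nr; near=> y.
have hy : nr (Phi N y - a) < r by near: y; exact: trap_near.
have hL : nr (blowup N y - blowup N x) <= L * nr (y - x) by near: y.
have := blowup_lim_near t hy hx.
rewrite subrACA.
move=> /le_trans; apply; have p4 : 0 <= (2^-1 : R) ^+ t / 4 by rewrite divr_ge0 // ltW.
apply: le_trans (ler_wpM2l p4 hL) _; rewrite mulrA ler_wpM2r ?nr_ge0 //.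
rewrite ltr_pdivlMr // in tP; have := mulr_gt0 (p0 t) L0; lra.
Unshelve. all: by end_near. Qed.

Lemma blowup_inv_ex v : exists x, basin x /\ blowup_lim x = v.
Proof.
have [N hN] := blowup_radius_unbounded (2 * nr v).
by have [x hx xv] := blowup_lim_surj hN; exists x; split => //; exists N.
Qed.
Definition blowup_inv : E -> E := projT1 (choice blowup_inv_ex).
Lemma basin_blowup_inv v : basin (blowup_inv v).
Proof. by have [] := projT2 (choice blowup_inv_ex) v. Qed.
Lemma blowup_invK v : blowup_lim (blowup_inv v) = v.
Proof. by have [] := projT2 (choice blowup_inv_ex) v. Qed.
Lemma blowup_limK x : basin x -> blowup_inv (blowup_lim x) = x.
Proof. by move=> bx; apply: blowup_lim_inj; rewrite ?blowup_invK //; exact: basin_blowup_inv. Qed.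

(** The inverse is Lipschitz at w: near w it takes its values in the set of the
    points trapped at a fixed time N, where the limit map is bi-Lipschitz with
    respect to the coordinates of [blowdown N]. *)
Lemma blowup_inv_diff w : differentiable blowup_inv w.
Proof.
rewrite -[w]blowup_invK; set x := blowup_inv w.
have bx : basin x := basin_blowup_inv w.
have xw : blowup_lim x = w := blowup_invK w.
have [N [hx Nw]] := basin_trap bx (2 * nr w + 2).
have [L L0 LP] := differentiable_lip (blowdown_diff N (blowup N x)).
have trapv v : nr (v - w) < 1 -> nr (Phi N (blowup_inv v) - a) < r.
  move=> vw; have [|y hy yv] := @blowup_lim_surj N v.
    apply: lt_trans Nw; have := nrD (v - w) w; rewrite subrK; lra.
  by rewrite -yv blowup_limK //; exists N.
have Gv v : nr (v - w) < 1 -> nr (blowup N (blowup_inv v) - blowup N x) <= 2 * nr (v - w).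
  move=> /trapv hv; have := blowup_lim_near0 hv hx; rewrite blowup_invK xw => h.
  have := nrB (v - w) ((v - w) - (blowup N (blowup_inv v) - blowup N x)).
  rewrite opprB addrCA subrr addr0; have := nr_ge0 (v - w); lra.
have wn : \forall v \near w, nr (v - w) < 1 by apply/nbhs_nr; exists 1.
apply: (@differentiable_inv R k blowup_lim blowup_inv x (L * 2)).
- exact: blowup_lim_diff.
- near=> y; apply: blowup_limK.
  by near: y; move: basin_open; rewrite openE => /(_ _ bx).
- by near=> v; exact: blowup_invK.
- rewrite xw; have [d d0 dP] := (nbhs_nr _ _).1 LP.
  near=> v; have vw : nr (v - w) < 1 by near: v.
  have h1 := Gv _ vw.
  have := dP (blowup N (blowup_inv v)); rewrite !blowupK => h2; apply: le_trans (h2 _) _.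
    apply: le_lt_trans h1 _.
    near: v; apply/nbhs_nr; exists (d / 2); first by rewrite divr_gt0.
    by move=> y; lra.
  by rewrite -mulrA ler_pM2l.
Unshelve. all: by end_near. Qed.

(** A second point fixed by the whole system shows that the basin is proper. *)
Lemma basin_fatou_bieberbach b : (forall n, Phi n b = b) -> r <= nr (b - a) ->
  fatou_bieberbach basin.
Proof.
move=> Pb ba; split.
- exact: basin_open.
- have -> : basin = blowup_inv @` [set: E].
    apply/seteqP; split => [x bx|x [v _ <-]]; last exact: basin_blowup_inv.
    by exists (blowup_lim x) => //; exact: blowup_limK.
  apply: connected_continuous_connected; first exact: connected_rV.
  apply: continuous_subspaceT => v.
  by have := differentiable_continuous (blowup_inv_diff v).
- apply/negP => /eqP bT; have : basin b by rewrite bT.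
  by move=> [N]; rewrite Pb ltNge ba.
- exists blowup_lim, blowup_inv; split.
  + by move=> z bz; exact: blowup_lim_diff.
  + by move=> z _; exact: blowup_inv_diff.
  + split => //.
    * by move=> x y; rewrite !inE; exact: blowup_lim_inj.
    * by move=> v _; exists (blowup_inv v); [exact: basin_blowup_inv|exact: blowup_invK].
  + by move=> x; rewrite inE; exact: blowup_limK.
Qed.
End Basin.

(** * Shears, and a contraction at many fixed points *)

Section Shears.
Context {R : realType} {k : nat}.
Local Notation C := R[i].
Local Notation E := 'rV[C]_k.
Implicit Types (x y z v : E) (s : 'I_k) (F : C -> C).

Lemma differentiable_mulmx (M : 'M[C]_k) x : differentiable (fun z : E => z *m M) x.
Proof.
apply/differentiable_nrP; exists (mulmxr M).
  by exists (k%:R * nr M) => h; exact: nr_mulmx.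
move=> e e0; exists 1 => // y _.
by rewrite /= mulmxBl subrr nr0 mulr_ge0 ?nr_ge0 // ltW.
Qed.

Definition shear s (F : C -> C) v z : E := z + F (z 0 s) *: v.

Lemma shear_diff s F v x : (forall t, differentiable F t) ->
  differentiable (shear s F v) x.
Proof.
move=> dF; have -> : shear s F v = id + (fun z => F (z 0 s) *: v) by [].
apply: differentiableD => //; apply: differentiableZl.
apply: (@differentiable_comp _ _ _ _ (fun z : E => z 0 s) F) => //.
exact: differentiable_coord.
Qed.

Lemma shearK s F v : v 0 s = 0 ->
  cancel (shear s F v) (shear s (fun t => - F t) v).
Proof.
by move=> vs z; rewrite /shear !mxE vs mulr0 addr0 scaleNr addrK.
Qed.

Lemma shear_exists s F v : v 0 s = 0 -> (forall t, differentiable F t) ->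
  exists f : auto R k, forall z, f z = z + F (z 0 s) *: v.
Proof.
move=> vs dF.
have dNF t : differentiable (fun t => - F t) t by apply: differentiableN.
have K2 : cancel (shear s (fun t => - F t) v) (shear s F v).
  by move=> z; rewrite /shear !mxE vs mulr0 addr0 scaleNr subrK.
by exists (Auto (shearK F vs) K2 (fun x => shear_diff s v x dF)
  (fun x => shear_diff s v x dNF)).
Qed.

Lemma diag_exists (d : 'rV[C]_k) : (forall j, d 0 j != 0) ->
  exists f : auto R k, forall z, f z = z *m diag_mx d.
Proof.
move=> d0.
have dd : diag_mx d *m diag_mx (\row_j (d 0 j)^-1) = 1%:M.
  rewrite mulmx_diag; apply/matrixP => i j; rewrite !mxE.
  by rewrite mulfV.
have dd' : diag_mx (\row_j (d 0 j)^-1) *m diag_mx d = 1%:M.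
  rewrite mulmx_diag; apply/matrixP => i j; rewrite !mxE.
  by rewrite mulVf.
have K1 : cancel (fun z : E => z *m diag_mx d)
    (fun z : E => z *m diag_mx (\row_j (d 0 j)^-1)).
  by move=> z; rewrite -mulmxA dd mulmx1.
have K2 : cancel (fun z : E => z *m diag_mx (\row_j (d 0 j)^-1))
    (fun z : E => z *m diag_mx d).
  by move=> z; rewrite -mulmxA dd' mulmx1.
by exists (Auto K1 K2 (differentiable_mulmx _) (differentiable_mulmx _)).
Qed.

Variable J : Type.

(** The point of this definition is that the constants do not depend on the
    index i, so that infinitely many points can be treated at once. *)
Definition uniformly_tangent (p : J -> E) (f : E -> E) (M : 'M[C]_k) :=
  exists K r : R, [/\ 0 <= K, 0 < r & forall i rho x y, rho <= r ->
    nr (x - p i) <= rho -> nr (y - p i) <= rho ->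
    nr (f x - f y - (x - y) *m M) <= K * rho * nr (x - y)].

Lemma uniformly_tangent_comp p f g M N :
  (forall z, nr (z *m M) <= nr z) -> (forall z, nr (z *m N) <= nr z) ->
  uniformly_tangent p f M -> uniformly_tangent (f \o p) g N -> uniformly_tangent p (g \o f) (M *m N).
Proof.
move=> M1 N1 [K1 [r1 [K10 r10 H1]]] [K2 [r2 [K20 r20 H2]]].
have K11 : 0 < K1 + 1 by rewrite ltr_wpDl.
exists (4 * K2 + K1), (Num.min (Num.min r1 (r2 / 2)) (K1 + 1)^-1).
split; first by rewrite addr_ge0 // mulr_ge0.
  by rewrite !lt_min r10 divr_gt0 // invr_gt0.
move=> i rho x y; rewrite !le_min => /andP[/andP[rr1 rr2] rr3] hx hy.
have rho0 : 0 <= rho by apply: le_trans hx; exact: nr_ge0.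
have Kr : K1 * rho <= 1.
  rewrite -(mulfV (lt0r_neq0 K11)); apply: ler_pM => //; lra.
have lip u v : nr (u - p i) <= rho -> nr (v - p i) <= rho ->
    nr (f u - f v) <= 2 * nr (u - v).
  move=> hu hv; have := H1 i rho u v rr1 hu hv => h.
  rewrite -(subrK ((u - v) *m M) (f u - f v)); apply: le_trans (nrD _ _) _.
  have := M1 (u - v); have := ler_wpM2r (nr_ge0 (u - v)) Kr; lra.
have hp : nr (p i - p i) <= rho by rewrite subrr nr0.
have fx : nr (f x - f (p i)) <= 2 * rho.
  by apply: le_trans (lip _ _ hx hp) _; rewrite ler_pM2l.
have fy : nr (f y - f (p i)) <= 2 * rho.
  by apply: le_trans (lip _ _ hy hp) _; rewrite ler_pM2l.
have r22 : 2 * rho <= r2 by lra.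
have h2 := H2 i _ _ _ r22 fx fy; have h1 := H1 i _ _ _ rr1 hx hy.
have -> : (g \o f) x - (g \o f) y - (x - y) *m (M *m N) =
  (g (f x) - g (f y) - (f x - f y) *m N) + (f x - f y - (x - y) *m M) *m N.
  by rewrite (mulmxBl (f x - f y)) -[_ *m M *m N]mulmxA addrA subrK.
apply: le_trans (nrD _ _) _.
have h3 := le_trans (N1 _) h1.
have K2r : 0 <= K2 * (2 * rho) by rewrite !mulr_ge0.
have h4 := ler_wpM2l K2r (lip _ _ hx hy).
apply: le_trans (lerD (le_trans h2 h4) h3) _.
by rewrite le_eqVlt; apply/orP; left; apply/eqP; ring.
Qed.

Lemma uniformly_tangent_mulmx p M : uniformly_tangent p (fun z => z *m M) M.
Proof.
exists 0, 1; split => // i rho x y _ _ _.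
by rewrite mulmxBl subrr nr0 !mul0r.
Qed.

(** The increment of the shear differs from that of the identity by
    (F x_s - F y_s) v, which is small as F is flat at the coordinates of the points. *)
Lemma uniformly_tangent_shear (p : J -> E) s F v (KF r : R) : 0 <= KF -> 0 < r ->
  (forall i rho t u, rho <= r -> nr (t - p i 0 s) <= rho ->
     nr (u - p i 0 s) <= rho -> nr (F t - F u) <= KF * rho * nr (t - u)) ->
  uniformly_tangent p (fun z => z + F (z 0 s) *: v) 1%:M.
Proof.
move=> K0 r0 HF; exists (KF * nr v), r; split => //.
  by rewrite mulr_ge0 ?nr_ge0.
move=> i rho x y rr hx hy; rewrite mulmx1.
have -> : x + F (x 0 s) *: v - (y + F (y 0 s) *: v) - (x - y) =
  (F (x 0 s) - F (y 0 s)) *: v by vring.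
have co (z w : E) : nr (z 0 s - w 0 s) <= nr (z - w).
  by have := nr_coord (z - w) 0 s; rewrite !mxE.
rewrite nrZ; have h := HF i rho _ _ rr (le_trans (co _ _) hx) (le_trans (co _ _) hy).
have rho0 : 0 <= rho by apply: le_trans hx; exact: nr_ge0.
have h2 : nr (F (x 0 s) - F (y 0 s)) <= KF * rho * nr (x - y).
  by apply: le_trans h _; apply: ler_wpM2l (co _ _); rewrite mulr_ge0.
have := ler_wpM2r (nr_ge0 v) h2.
by move=> /le_trans; apply; rewrite le_eqVlt; apply/orP; left; apply/eqP; ring.
Qed.

Lemma nr_mul_diag (d : E) z : (forall j, nr (d 0 j) <= 1) ->
  nr (z *m diag_mx d) <= nr z.
Proof.
move=> d1; apply: nr_le => [|i j]; first exact: nr_ge0.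
rewrite mul_mx_diag mxE nrM (le_trans _ (nr_coord z i j)) //.
by rewrite ler_piMr ?nr_ge0.
Qed.

Definition axis_point (i : 'I_k) (t : C) : E := t *: delta_mx 0 i.

Lemma axis_pointE i t j : axis_point i t 0 j = t * (j == i)%:R.
Proof. by rewrite !mxE eqxx. Qed.
Lemma axis_point_id i t : axis_point i t 0 i = t.
Proof. by rewrite axis_pointE eqxx mulr1. Qed.
Lemma axis_pointB i t u : axis_point i (t - u) = axis_point i t - axis_point i u.
Proof. exact: scalerBl. Qed.
Lemma nr_axis_point i t : nr (axis_point i t) = nr t.
Proof.
apply/eqP; rewrite eq_le; apply/andP; split.
  apply: nr_le => [|s j]; first exact: nr_ge0.
  by rewrite !mxE; case: (_ && _); rewrite ?mulr1 ?mulr0 ?nr0 ?nr_ge0.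
by rewrite -{1}(axis_point_id i t) nr_coord.
Qed.

(** Put g = id - Q, so that g(alpha_i) = alpha_i and g'(alpha_i) = 0.  In the
    coordinates z, w of indices i0 and i1, contract w, add g(z) to w: the points
    (alpha_i, 0) go to (alpha_i, alpha_i).  Replace z with c z + (1 - c) g(w),
    which fixes these points and contracts z, then subtract g(z) from w.  The
    shears have the identity as differential along the way, so the differential
    of the composition is the product of the two diagonal maps. *)
Lemma contracting_auto (i0 i1 : 'I_k) (alpha : J -> C) (Q : C -> C) (c K r0 : R) :
  i0 != i1 -> 0 < c -> c <= 1 -> 0 <= K -> 0 < r0 ->
  (forall t, differentiable Q t) -> (forall i, Q (alpha i) = 0) ->
  (forall i rho t u, rho <= r0 -> nr (t - alpha i) <= rho ->
     nr (u - alpha i) <= rho -> nr (Q t - Q u - (t - u)) <= K * rho * nr (t - u)) ->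
  exists A : auto R k, (forall t, Q t = 0 -> A (axis_point i0 t) = axis_point i0 t) /\
    uniformly_tangent (fun i => axis_point i0 (alpha i)) A (c%:C)%:M.
Proof.
move=> i01 c0 c1 K0 r00 dQ Qa HQ.
pose g t := t - Q t.
have dg t : differentiable g t.
  have -> : g = id - Q by [].
  exact: differentiableB.
have dg' (a : C) t : differentiable (fun t => a * g t) t.
  have -> : (fun t => a * g t) = a *: g by [].
  exact: differentiableZ.
have gP i rho t u : rho <= r0 -> nr (t - alpha i) <= rho ->
     nr (u - alpha i) <= rho -> nr (g t - g u) <= K * rho * nr (t - u).
  move=> h1 h2 h3; rewrite /g subrACA nrBC; exact: HQ h3.
have g'P (a : C) : nr a <= 1 -> forall i rho t u, rho <= r0 -> nr (t - alpha i) <= rho ->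
     nr (u - alpha i) <= rho -> nr (a * g t - a * g u) <= K * rho * nr (t - u).
  move=> a1 i rho t u h1 h2 h3; apply: le_trans (gP i rho t u h1 h2 h3).
  by rewrite -mulrBr nrM ler_piMl ?nr_ge0.
have cC : c%:C != 0 :> C by rewrite -(rmorph0 (real_complex R)) (inj_eq (@complexI R)) gt_eqF.
pose d1 : E := \row_j (if j == i0 then 1 else c%:C).
pose d2 : E := \row_j (if j == i0 then c%:C else 1).
have [|D1 D1E] := @diag_exists d1; first by move=> j; rewrite mxE; case: ifP; rewrite ?oner_eq0.
have [|D2 D2E] := @diag_exists d2; first by move=> j; rewrite mxE; case: ifP; rewrite ?oner_eq0.
have e01 : axis_point i1 1 0 i0 = 0 by rewrite axis_pointE (negPf i01) mulr0.
have e10 : axis_point i0 1 0 i1 = 0 by rewrite axis_pointE eq_sym (negPf i01) mulr0.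
have [S1 S1E] := shear_exists e01 dg.
have [S2 S2E] := shear_exists e10 (dg' (1 - c%:C)).
have [S3 S3E] := shear_exists e01 (dg' (-1)).
have n1 : nr (1 : C) = 1 by rewrite nr1.
have nc : nr (c%:C : C) <= 1 by rewrite nr_real gtr0_norm.
have M1 z : nr (z *m (1%:M : 'M[C]_k)) <= nr z by rewrite mulmx1.
have Md1 z : nr (z *m diag_mx d1) <= nr z.
  by apply: nr_mul_diag => j; rewrite mxE; case: ifP; rewrite ?n1.
have Md2 z : nr (z *m diag_mx d2) <= nr z.
  by apply: nr_mul_diag => j; rewrite mxE; case: ifP; rewrite ?n1.
have d12 : diag_mx d1 *m diag_mx d2 = (c%:C)%:M.
  rewrite mulmx_diag; apply/matrixP => i j; rewrite !mxE.
  by case: ifP; rewrite ?mul1r ?mulr1.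
pose q t := axis_point i0 t + axis_point i1 t.
have q0 t : q t 0 i0 = t by rewrite mxE axis_point_id axis_pointE (negPf i01) mulr0 addr0.
have q1 t : q t 0 i1 = t by rewrite mxE axis_point_id axis_pointE eq_sym (negPf i01) mulr0 add0r.
have gQ t : Q t = 0 -> g t = t by rewrite /g => ->; rewrite subr0.
have D1p t : D1 (axis_point i0 t) = axis_point i0 t.
  rewrite D1E mul_mx_diag; apply/rowP => j; rewrite !mxE eqxx /=.
  by case: eqP; rewrite ?mulr1 ?mulr0 ?mul0r.
have S1p t : Q t = 0 -> S1 (axis_point i0 t) = q t.
  by move=> Qt; rewrite S1E axis_point_id gQ // /q /axis_point scale1r.
have D2q t : D2 (q t) = axis_point i0 (c%:C * t) + axis_point i1 t.
  rewrite D2E mul_mx_diag; apply/rowP => j; rewrite !mxE eqxx /=.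
  case: eqP => [->|_]; rewrite ?(negPf i01) ?mulr1 ?mulr0 ?addr0 1?mulrC //.
have D2q1 t : D2 (q t) 0 i1 = t.
  by rewrite D2q mxE axis_point_id axis_pointE eq_sym (negPf i01) mulr0 add0r.
have S2p t : Q t = 0 -> S2 (D2 (q t)) = q t.
  move=> Qt; rewrite S2E D2q1 gQ // D2q /q /axis_point; vring.
have S3p t : Q t = 0 -> S3 (q t) = axis_point i0 t.
  move=> Qt; rewrite S3E q0 gQ // /q /axis_point; vring.
exists (auto_comp S3 (auto_comp S2 (auto_comp D2 (auto_comp S1 D1)))); split.
  by move=> t Qt /=; rewrite D1p S1p // S2p // S3p.
have -> : (c%:C)%:M = (((diag_mx d1 *m 1%:M) *m diag_mx d2) *m 1%:M) *m 1%:M :> 'M[C]_k.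
  by rewrite !mulmx1.
have ext p f f' M : f =1 f' -> uniformly_tangent p f' M -> uniformly_tangent p f M by move=> /funext ->.
have TD1 p : uniformly_tangent p D1 (diag_mx d1) by apply: ext D1E _; exact: uniformly_tangent_mulmx.
have TD2 p : uniformly_tangent p D2 (diag_mx d2) by apply: ext D2E _; exact: uniformly_tangent_mulmx.
have Mc z : nr (z *m (diag_mx d1 *m diag_mx d2)) <= nr z.
  by rewrite mulmxA (le_trans (Md2 _)).
apply: uniformly_tangent_comp => //; first by move=> z; rewrite !mulmx1.
  apply: uniformly_tangent_comp => //; first by move=> z; rewrite !mulmx1.
    apply: uniformly_tangent_comp => //; first by move=> z; rewrite !mulmx1.
      apply: uniformly_tangent_comp => //.
      apply: (ext _ _ _ _ S1E); apply: (@uniformly_tangent_shear _ _ _ _ K r0) => // i.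
      by rewrite /= D1p axis_point_id; exact: gP.
  apply: (ext _ _ _ _ S2E); apply: (@uniformly_tangent_shear _ i1 (fun t => (1 - c%:C) * g t) _ K r0) => // i.
  rewrite /= D1p S1p // D2q1; apply: g'P.
  by rewrite -(rmorph1 (real_complex R)) -rmorphB nr_real ger0_norm; lra.
apply: (ext _ _ _ _ S3E); apply: (@uniformly_tangent_shear _ i0 (fun t => -1 * g t) _ K r0) => // i.
rewrite /= D1p S1p // S2p // q0; apply: g'P.
by rewrite nrN n1.
Qed.
End Shears.

(** * Moving one point while barely moving the fixed points *)

Section Moves.
Context {R : realType} {k : nat}.
Local Notation C := R[i].
Local Notation E := 'rV[C]_k.

(** From u^(n+1) - w^(n+1) = (u - w) (u^n + ... + w^n). *)
Lemma nr_subX (u w : C) (m : R) n : nr u <= m -> nr w <= m ->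
  nr (u ^+ n.+1 - w ^+ n.+1) <= n.+1%:R * m ^+ n * nr (u - w).
Proof.
move=> um wm; have m0 : 0 <= m by apply: le_trans um; exact: nr_ge0.
elim: n => [|n IH]; first by rewrite !expr1 expr0 !mul1r.
have -> : u ^+ n.+2 - w ^+ n.+2 = u * (u ^+ n.+1 - w ^+ n.+1) + (u - w) * w ^+ n.+1.
  by rewrite !(exprS _ n.+1); ring.
apply: le_trans (nrD _ _) _; rewrite !nrM nrX.
have h1 : nr w ^+ n.+1 <= m ^+ n.+1 by apply: lerXn2r; rewrite ?nnegrE ?nr_ge0.
have h2 := ler_pM (nr_ge0 _) (nr_ge0 _) um IH.
have h3 := ler_wpM2l (nr_ge0 (u - w)) h1.
apply: le_trans (lerD h2 h3) _.
rewrite [n.+2%:R]mulrS exprS le_eqVlt; apply/orP; left; apply/eqP; ring.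
Qed.

Lemma linear_geo_small (e : R) : 0 < e -> exists n, n.+2%:R * 2^-1 ^+ n < e.
Proof.
move=> e0; have e2 : 0 < e / 2 by rewrite divr_gt0.
have [t tP] := half_small e2; exists (t + t)%N.
have p0 : 0 < (2^-1 : R) ^+ t by rewrite exprn_gt0 // invr_gt0.
have h : (t.+1%:R : R) * 2^-1 ^+ t <= 1.
  elim: t {tP p0} => [|t IH]; first by rewrite expr0 mulr1.
  rewrite exprS mulrA -[t.+2%:R]natr1 mulrAC; apply: le_trans IH.
  have q0 : 0 <= (2^-1 : R) ^+ t by rewrite exprn_ge0 // invr_ge0.
  have h1 : (1 : R) <= t.+1%:R by rewrite ler1n.
  by have := ler_wpM2r q0 h1; lra.
have -> : (t + t).+2%:R = 2 * t.+1%:R :> R by rewrite -natrM mul2n -addnn addnS addSn.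
rewrite exprD; have := ler_wpM2r (ltW p0) h.
set p := 2^-1 ^+ t in tP p0 h *; set n := t.+1%:R in h *.
have -> : 2 * n * (p * p) = 2 * (n * p * p) by ring.
lra.
Qed.

Section Flat.
Variables (J : Type) (a : J -> E) (b : E).

Definition flat (e rho : R) (f : E -> E) := forall i s x y, s <= rho ->
  nr (x - a i) <= s -> nr (y - a i) <= s -> nr (f x - f y - (x - y)) <= e * s * nr (x - y).

(** The quantifier over e is inside: the same displacement of p is possible with
    arbitrarily little effect near the points a_i. *)
Definition reach (rho : R) (p q : E) := forall e, 0 < e -> exists f : auto R k,
  [/\ forall i, f (a i) = a i, f b = b, flat e rho f & f p = q].

Lemma reachW rho rho' p q : rho' <= rho -> reach rho p q -> reach rho' p q.
Proof.
move=> h H e /H[f [h1 h2 h3 h4]]; exists f; split => // i s x y sr.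
by apply: h3; exact: le_trans h.
Qed.

Lemma flat_lip e rho f i s x y : flat e rho f -> 0 <= e -> e * rho <= 1 -> s <= rho ->
  nr (x - a i) <= s -> nr (y - a i) <= s -> nr (f x - f y) <= 2 * nr (x - y).
Proof.
move=> ff e0 er sr hx hy; have h := ff i s x y sr hx hy.
rewrite -(subrK (x - y) (f x - f y)); apply: le_trans (nrD _ _) _.
have es : e * s <= 1 by apply: le_trans er; exact: ler_wpM2l.
have := ler_wpM2r (nr_ge0 (x - y)) es; lra.
Qed.

(** The first map may enlarge the balls around the points a_i, but at most by a
    factor 2. *)
Lemma reach_trans rho p q q' : 0 < rho -> reach rho p q -> reach (2 * rho) q q' ->
  reach rho p q'.
Proof.
move=> rho0 H1 H2 e e0.
have e8 : 0 < e / 8 by rewrite divr_gt0.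
have e1 : 0 < Num.min (e / 2) rho^-1 by rewrite lt_min divr_gt0 // invr_gt0.
have [f [f1 f2 f3 f4]] := H1 _ e1; have [g [g1 g2 g3 g4]] := H2 _ e8.
set d := Num.min _ _ in e1 f3.
have dr : d * rho <= 1.
  by rewrite -ler_pdivlMr // mul1r /d ge_min lexx orbT.
have de : d <= e / 2 by rewrite /d ge_min lexx.
exists (auto_comp g f); split => [i|||] /=; rewrite ?f1 ?f2 ?f4 //.
move=> i s x y sr hx hy /=.
have s0 : 0 <= s by apply: le_trans hx; exact: nr_ge0.
have ha : nr (a i - a i) <= s by rewrite subrr nr0.
have hfx : nr (f x - a i) <= 2 * s.
  rewrite -{1}(f1 i); apply: le_trans (flat_lip f3 (ltW e1) dr sr hx ha) _.
  by rewrite ler_pM2l.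
have hfy : nr (f y - a i) <= 2 * s.
  rewrite -{1}(f1 i); apply: le_trans (flat_lip f3 (ltW e1) dr sr hy ha) _.
  by rewrite ler_pM2l.
have sr2 : 2 * s <= 2 * rho by rewrite ler_pM2l.
rewrite (subr_mid (f x - f y)); apply: le_trans (nrD _ _) _.
have h1 := g3 i _ _ _ sr2 hfx hfy; have h2 := f3 i _ _ _ sr hx hy.
have h3 := flat_lip f3 (ltW e1) dr sr hx hy.
have c1 : 0 <= e / 8 * (2 * s) by rewrite !mulr_ge0 // ltW.
have h4 := le_trans h1 (ler_wpM2l c1 h3).
have h5 := ler_wpM2r (mulr_ge0 s0 (nr_ge0 (x - y))) de.
apply: le_trans (lerD h4 h2) _.
rewrite -[d * s * _]mulrA; apply: le_trans (lerD (lexx _) h5) _.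
by rewrite le_eqVlt; apply/orP; left; apply/eqP; field.
Qed.

(** Shear by F = (X / X(p_s))^(n+2) (X - X(b_s)) / (X(p_s) - X(b_s)).  It is equal
    to 1 at p_s and vanishes at b_s and at the points.  On the balls to be preserved
    |X / X(p_s)| is at most 1/2, so the Lipschitz constant of F there is of order
    n / 2^n. *)
Lemma shear_reach (s : 'I_k) (v : E) (X : C -> C) (L rho : R) (p : E) :
  v 0 s = 0 -> (forall t, differentiable X t) -> 0 < rho -> 0 <= L ->
  (forall i, X (a i 0 s) = 0) ->
  (forall i t u, nr (t - a i 0 s) <= rho -> nr (u - a i 0 s) <= rho ->
     nr (X t - X u) <= L * nr (t - u)) ->
  X (p 0 s) != 0 -> 2 * L * rho <= nr (X (p 0 s)) -> X (p 0 s) != X (b 0 s) ->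
  reach rho p (p + v).
Proof.
move=> vs dX rho0 L0 Xa XL Xp0 XpL Xpb e e0.
set Xp := X (p 0 s) in Xp0 XpL Xpb; set Xb := X (b 0 s) in Xpb.
have nXp : 0 < nr Xp by rewrite lt_def nr_eq0 Xp0 nr_ge0.
have nXb : 0 < nr (Xp - Xb) by rewrite lt_def nr_eq0 subr_eq0 Xpb nr_ge0.
pose t := L / nr Xp; pose t' := L / nr (Xp - Xb).
pose W := (L * rho + nr Xb) / nr (Xp - Xb).
have t0 : 0 <= t by rewrite divr_ge0 // nr_ge0.
have t'0 : 0 <= t' by rewrite divr_ge0 // nr_ge0.
have W0 : 0 <= W by rewrite divr_ge0 ?nr_ge0 // addr_ge0 ?nr_ge0 // mulr_ge0 // ltW.
pose Z := t * (W * t + t') * nr v.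
have Z0 : 0 <= Z := mulr_ge0 (mulr_ge0 t0 (addr_ge0 (mulr_ge0 W0 t0) t'0)) (nr_ge0 v).
have Z1 : 0 < Z + 1 by rewrite ltr_wpDl.
have [n nP] := linear_geo_small (divr_gt0 e0 Z1).
pose F x := (Xp^-1 * X x) ^+ n.+2 * ((Xp - Xb)^-1 * (X x - Xb)).
have dF x : differentiable F x.
  have -> : F = (Xp^-1 *: X) ^+ n.+2 * ((Xp - Xb)^-1 *: (X - cst Xb)).
    by apply/funext => y; rewrite /F !fctE.
  apply: differentiableM.
    by apply: differentiableX; apply: differentiableZ; exact: dX.
  by apply: differentiableZ; apply: differentiableB => //; exact: dX.
have [f fE] := shear_exists vs dF; exists f; split.
- by move=> i; rewrite fE /F Xa mulr0 expr0n mul0r scale0r addr0.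
- by rewrite fE /F -/Xb subrr !mulr0 scale0r addr0.
- move=> i r x y rr hx hy; rewrite !fE.
  have -> : x + F (x 0 s) *: v - (y + F (y 0 s) *: v) - (x - y) =
    (F (x 0 s) - F (y 0 s)) *: v by move: (F (x 0 s)) (F (y 0 s)) => ? ?; vring.
  have r0 : 0 <= r by apply: le_trans hx; exact: nr_ge0.
  have co (z w : E) : nr (z 0 s - w 0 s) <= nr (z - w).
    by have := nr_coord (z - w) 0 s; rewrite !mxE.
  rewrite nrZ.
  set x' := x 0 s; set y' := y 0 s; set a' := a i 0 s.
  have hx' : nr (x' - a') <= r by apply: le_trans hx; exact: co.
  have hy' : nr (y' - a') <= r by apply: le_trans hy; exact: co.
  have Xxy : nr (X x' - X y') <= L * nr (x - y).
    apply: le_trans (XL i _ _ (le_trans hx' rr) (le_trans hy' rr)) _.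
    by apply: ler_wpM2l => //; exact: co.
  have aa : nr (a' - a') <= rho by rewrite subrr nr0 ltW.
  have Xz z : nr (z - a') <= r -> nr (X z) <= L * r.
    move=> hz; have := XL i _ _ (le_trans hz rr) aa; rewrite Xa subr0 => h.
    by apply: le_trans h _; apply: ler_wpM2l.
  have uz z : nr (z - a') <= r -> nr (Xp^-1 * X z) <= t * r.
    move=> hz; rewrite nrM nrV mulrC /t mulrAC; apply: ler_wpM2r; last exact: Xz.
    by rewrite invr_ge0 ltW.
  have uxy : nr (Xp^-1 * X x' - Xp^-1 * X y') <= t * nr (x - y).
    rewrite -mulrBr nrM nrV mulrC /t mulrAC; apply: ler_wpM2r => //.
    by rewrite invr_ge0 ltW.
  have wz z : nr (z - a') <= r -> nr ((Xp - Xb)^-1 * (X z - Xb)) <= W.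
    move=> hz; rewrite nrM nrV mulrC /W; apply: ler_wpM2r; first by rewrite invr_ge0 ltW.
    apply: le_trans (nrB _ _) _; rewrite lerD2r (le_trans (Xz _ hz)) //.
    by apply: ler_wpM2l.
  have wxy : nr ((Xp - Xb)^-1 * (X x' - Xb) - (Xp - Xb)^-1 * (X y' - Xb)) <= t' * nr (x - y).
    rewrite -mulrBr opprB addrA subrK nrM nrV mulrC /t' mulrAC; apply: ler_wpM2r => //.
    by rewrite invr_ge0 ltW.
  have tr : t * r <= 2^-1.
    apply: le_trans (ler_wpM2l t0 rr) _.
    rewrite /t mulrAC ler_pdivrMr //; lra.
  have tr0 : 0 <= t * r by rewrite mulr_ge0.
  have trn : (t * r) ^+ n.+1 <= t * r * 2^-1 ^+ n.
    by rewrite exprS ler_wpM2l // lerXn2r // ?nnegrE ?invr_ge0.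
  have trn2 : (t * r) ^+ n.+2 <= t * r * 2^-1 ^+ n.
    by rewrite exprS (le_trans _ trn) // ler_piMl ?exprn_ge0 // (le_trans tr) // invf_le1 // ler1n.
  rewrite /F.
  set u := Xp^-1 * X x' in uxy *; set w := Xp^-1 * X y' in uxy *.
  set m := _ * (X x' - Xb) in wxy *; set q := _ * (X y' - Xb) in wxy *.
  have hu : nr u <= t * r by exact: uz.
  have hw : nr w <= t * r by exact: uz.
  have hm : nr m <= W by exact: wz.
  have h1 := nr_subX n.+1 hu hw.
  have -> : u ^+ n.+2 * m - w ^+ n.+2 * q = (u ^+ n.+2 - w ^+ n.+2) * m + w ^+ n.+2 * (m - q).
    by ring.
  have N0 := nr_ge0 (x - y); set N := nr (x - y) in uxy wxy N0 *.
  have p0 : 0 <= (2^-1 : R) ^+ n by rewrite exprn_ge0 // invr_ge0.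
  have g1 : nr ((u ^+ n.+2 - w ^+ n.+2) * m) <= n.+2%:R * 2^-1 ^+ n * r * (t * (t * W)) * N.
    rewrite nrM; apply: le_trans (ler_pM (nr_ge0 _) (nr_ge0 _) h1 hm) _.
    have -> : n.+2%:R * 2^-1 ^+ n * r * (t * (t * W)) * N =
       n.+2%:R * (t * r * 2^-1 ^+ n) * (t * N) * W by ring.
    apply: ler_wpM2r => //; apply: ler_pM => //; rewrite ?nr_ge0 // ?mulr_ge0 ?exprn_ge0 //.
    exact: ler_wpM2l.
  have g2 : nr (w ^+ n.+2 * (m - q)) <= n.+2%:R * 2^-1 ^+ n * r * (t * t') * N.
    rewrite nrM nrX.
    have hw2 : nr w ^+ n.+2 <= t * r * 2^-1 ^+ n.
      by apply: le_trans trn2; apply: lerXn2r; rewrite ?nnegrE ?nr_ge0.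
    apply: le_trans (ler_pM (exprn_ge0 _ (nr_ge0 _)) (nr_ge0 _) hw2 wxy) _.
    have -> : t * r * 2^-1 ^+ n * (t' * N) = 1 * (2^-1 ^+ n * r * (t * t') * N) by ring.
    have -> : n.+2%:R * 2^-1 ^+ n * r * (t * t') * N =
       n.+2%:R * (2^-1 ^+ n * r * (t * t') * N) by ring.
    apply: ler_wpM2r; last by rewrite ler1n.
    by rewrite !mulr_ge0 // invr_ge0 ltW.
  have h4 := le_trans (nrD _ _) (lerD g1 g2).
  apply: le_trans (ler_wpM2r (nr_ge0 v) h4) _.
  have -> : (n.+2%:R * 2^-1 ^+ n * r * (t * (t * W)) * N +
     n.+2%:R * 2^-1 ^+ n * r * (t * t') * N) * nr v =
     n.+2%:R * 2^-1 ^+ n * Z * (r * N) by rewrite /Z; ring.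
  rewrite -[e * r * N]mulrA; apply: ler_wpM2r; first by rewrite mulr_ge0.
  rewrite ltr_pdivlMr // in nP; apply: le_trans (ltW nP); apply: ler_wpM2l.
    by rewrite mulr_ge0.
  by rewrite lerDl.
- by rewrite fE /F -/Xp !mulVf ?subr_eq0 // expr1n mulr1 scale1r.
Qed.
End Flat.

End Moves.

(** * The dynamical system *)

(** The attracting points are [a i], with first coordinate [alpha i] and all the
    others zero; [b] is one more fixed point of the system, not attracting unless it
    is one of the [a i].  The function P vanishes to order one at the numbers
    [alpha i] and is bounded from below away from them, both uniformly: P is used to
    move points near the axis.  The function Q is used to build the contraction;
    it may have more zeros than P.  By [proper], each basin misses either [b] or
    another attracting point. *)
Section Construction.
Context {R : realType} {k : nat}.
Local Notation C := R[i].
Local Notation E := 'rV[C]_k.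
Variables (J : countType) (i0 i1 : 'I_k) (alpha : J -> C) (beta : C) (P Q : C -> C).
Variables (r0 L mu K : R).
Hypotheses (i01 : i0 != i1).
Hypotheses (dP : forall t, differentiable P t) (dQ : forall t, differentiable Q t).
Hypotheses (r00 : 0 < r0) (L1 : 1 <= L) (mu0 : 0 < mu) (mu1 : mu <= 1) (K0 : 0 <= K).
Hypothesis sep : forall i j, i != j -> 2 * r0 <= nr (alpha i - alpha j).
Hypothesis Pa : forall i, P (alpha i) = 0.
Hypothesis Plip : forall i t u, nr (t - alpha i) <= r0 -> nr (u - alpha i) <= r0 ->
  nr (P t - P u) <= L * nr (t - u).
Hypothesis Plow : forall rho z, 0 < rho -> rho <= r0 ->
  (forall i, rho <= nr (z - alpha i)) -> mu * rho <= nr (P z).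
Hypothesis Pgen : forall t e, 0 < e -> exists u, nr (u - t) < e /\ P u != P beta.
Hypothesis Qa : forall i, Q (alpha i) = 0.
Hypothesis Qb : Q beta = 0.
Hypothesis Qlip : forall i rho t u, rho <= r0 -> nr (t - alpha i) <= rho ->
  nr (u - alpha i) <= rho -> nr (Q t - Q u - (t - u)) <= K * rho * nr (t - u).
Hypothesis proper : forall j, P beta != 0 \/ exists i : J, i != j.

Let a i : E := axis_point i0 (alpha i).
Let b : E := axis_point i0 beta.

Let a0 i : a i 0 i0 = alpha i. Proof. exact: axis_point_id. Qed.
Let as0 i s : s != i0 -> a i 0 s = 0.
Proof. by move=> h; rewrite axis_pointE (negPf h) mulr0. Qed.
Let b0 : b 0 i0 = beta. Proof. exact: axis_point_id. Qed.
Let bs0 s : s != i0 -> b 0 s = 0.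
Proof. by move=> h; rewrite axis_pointE (negPf h) mulr0. Qed.

Lemma rowBE (u w : E) s : (u - w) 0 s = u 0 s - w 0 s.
Proof. by rewrite !mxE. Qed.

Lemma dist_sep i j : i != j -> 2 * r0 <= nr (a i - a j).
Proof. by move=> ij; rewrite -axis_pointB nr_axis_point; exact: sep. Qed.

Section Radius.
Variables (c r : R).
Hypotheses (c0 : 0 < c) (cmu : 32 * L * c <= mu) (r_gt0 : 0 < r) (rr0 : r <= r0).
Hypothesis rb : P beta = 0 \/ L * r < nr (P beta).

(** Shear with X = P in [shear_reach]: by [Plow], P is larger at p than on the balls
    that have to be preserved. *)
Lemma move_vertical (v p : E) rho : v 0 i0 = 0 -> 0 < rho -> rho <= 8 * c * r ->
  (forall i, r / 2 <= nr (p 0 i0 - alpha i)) -> P (p 0 i0) != P beta ->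
  reach a b rho p (p + v).
Proof.
move=> v0 rho0 rhor h hb.
have r2 : 0 < r / 2 by rewrite divr_gt0.
have r2r0 : r / 2 <= r0 by have := r_gt0; have := rr0; lra.
have low := Plow r2 r2r0 h.
have c32 : c <= 1 / 32.
  have h1 := ler_wpM2r (ltW c0) L1; have := cmu; have := mu1; lra.
have rho_r0 : rho <= r0.
  have h1 := ler_wpM2r (ltW r_gt0) c32; have := rr0; have := r_gt0; lra.
have h2 : 2 * L * rho <= mu * (r / 2).
  have L0 : 0 <= 2 * L by have := L1; lra.
  have h3 := ler_wpM2l L0 rhor; have h4 := ler_wpM2r (ltW r_gt0) cmu; lra.
apply: (@shear_reach _ _ _ _ _ i0 v P L rho) => //.
- by have := L1; lra.
- by move=> j; rewrite a0.
- by move=> j t u; rewrite a0 => ht hu; apply: (Plip (i := j)); exact: le_trans rho_r0.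
- by rewrite -nr_eq0 gt_eqF // (lt_le_trans _ low) // mulr_gt0.
- exact: le_trans low.
- by rewrite b0.
Qed.

(** Shear with X the s-th coordinate, which vanishes at all the points [a i]. *)
Lemma move_horizontal s (v p : E) rho : s != i0 -> v 0 s = 0 -> 0 < rho -> rho <= 8 * c * r ->
  r / 2 <= nr (p 0 s) -> reach a b rho p (p + v).
Proof.
move=> si v0 rho0 rhor h.
have r2 : 0 < r / 2 by rewrite divr_gt0.
have c32 : c <= 1 / 32.
  have h1 := ler_wpM2r (ltW c0) L1; have := cmu; have := mu1; lra.
have rho4 : rho <= r / 4.
  have h1 := ler_wpM2r (ltW r_gt0) c32; lra.
apply: (@shear_reach _ _ _ _ _ s v id 1 rho) => //.
- by move=> j; rewrite as0.
- by move=> j t u _ _; rewrite mul1r.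
- by rewrite -nr_eq0 gt_eqF // (lt_le_trans r2).
- by apply: le_trans h; lra.
- by rewrite bs0 // -nr_eq0 gt_eqF // (lt_le_trans r2).
Qed.

(** Move first horizontally until the first coordinate is alpha_j + r / 2, then
    vertically to the axis. *)
Lemma move_in_off j s (p : E) : s != i0 -> r / 2 <= nr (p 0 s) ->
  exists2 q, nr (q - a j) < r & reach a b (4 * c * r) p q.
Proof.
move=> si hs; pose t := alpha j + (r / 2)%:C.
have r2 : 0 < r / 2 by rewrite divr_gt0.
have nt : nr (t - alpha j) = r / 2 by rewrite /t addrC addKr nr_real gtr0_norm.
pose v : E := axis_point i0 (t - p 0 i0).
pose p' := p + v.
have p't : p' 0 i0 = t by rewrite mxE axis_point_id addrC subrK.
pose w : E := axis_point i0 t - p'.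
exists (axis_point i0 t); first by rewrite /a -axis_pointB nr_axis_point nt; have := r_gt0; lra.
have cr : 0 < c * r by rewrite mulr_gt0.
apply: (@reach_trans _ _ _ _ _ _ _ p').
- lra.
- apply: (@move_horizontal s) => //; [|lra|lra].
  by rewrite /v axis_pointE (negPf si) mulr0.
have -> : axis_point i0 t = p' + w by rewrite /w addrC subrK.
apply: move_vertical => //.
- by rewrite /w rowBE axis_point_id p't subrr.
- lra.
- lra.
- move=> i; rewrite p't; have [->|ij] := eqVneq i j; first by rewrite nt.
  have := sep ij; rewrite (subr_mid t) => h.
  have := le_trans h (nrD _ _); rewrite nt [nr (_ - t)]nrBC.
  have := rr0; lra.
- rewrite p't.
  have low : mu * (r / 2) <= nr (P t).
    apply: Plow => //; first by have := rr0; have := r_gt0; lra.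
    move=> i; have [->|ij] := eqVneq i j; first by rewrite nt.
    have := sep ij; rewrite (subr_mid t) => h.
    have := le_trans h (nrD _ _); rewrite nt [nr (_ - t)]nrBC.
    have := rr0; lra.
  have Pt0 : 0 < nr (P t) by apply: lt_le_trans low; rewrite mulr_gt0.
  have [->|hb] := rb; first by rewrite -nr_eq0 gt_eqF.
  apply/eqP => Ptb; move: hb; rewrite -Ptb.
  have tr : nr (t - alpha j) <= r0 by rewrite nt; have := rr0; have := r_gt0; lra.
  have aj : nr (alpha j - alpha j) <= r0 by rewrite subrr nr0 ltW.
  have := Plip tr aj; rewrite Pa subr0 nt => h.
  have Lr : 0 < L * r by rewrite mulr_gt0 //; have := L1; lra.
  lra.
Qed.

(** A point outside of the balls has either a coordinate other than the first that
    is not small, or a first coordinate away from all the [alpha i]; in the latter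
    case one vertical move leads to the former. *)
Lemma move_in j (p : E) : (forall i, r / 2 <= nr (p - a i)) -> P (p 0 i0) != P beta ->
  exists2 q, nr (q - a j) < r & reach a b (2 * c * r) p q.
Proof.
move=> h hb; have cr : 0 < c * r by rewrite mulr_gt0.
have [[s [si hs]]|no] := pselect (exists s, s != i0 /\ r / 2 <= nr (p 0 s)).
  have [q h1 h2] := move_in_off j si hs; exists q => //.
  by apply: reachW h2; lra.
pose v : E := axis_point i1 (r%:C - p 0 i1).
have v0 : v 0 i0 = 0 by rewrite axis_pointE (negPf i01) mulr0.
have i10 : i1 != i0 by rewrite eq_sym.
have p1 : r / 2 <= nr ((p + v) 0 i1).
  rewrite mxE axis_point_id addrC subrK nr_real gtr0_norm //; have := r_gt0; lra.
have [q h1 h2] := move_in_off j i10 p1; exists q => //.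
apply: (@reach_trans _ _ _ _ _ _ _ (p + v)); [lra| |].
  apply: move_vertical => //; [lra|lra|].
  move=> i; rewrite leNgt; apply/negP => hi.
  have := h i; apply/negP; rewrite -ltNge.
  apply: nr_lt => [|x l]; first by rewrite divr_gt0.
  rewrite ord1 !mxE eqxx /=; have [->|li] := eqVneq l i0; first by rewrite mulr1.
  rewrite mulr0 subr0 ltNge; apply/negP => hl.
  by apply: no; exists l.
by apply: reachW h2; lra.
Qed.

(** A rational center, a natural number s for the radius 1 / (s + 1), and the index
    of the basin that the ball has to meet. *)
Definition target : countType := ('rV[rat]_k * 'rV[rat]_k * nat * J)%type.
Definition target_center (t : target) : E :=
  \row_j ((ratr (t.1.1.1 0 j) : R) +i* (ratr (t.1.1.2 0 j) : R)).
Definition target_ball (t : target) : set E :=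
  [set z | nr (z - target_center t) < (t.1.2.+1%:R)^-1].

Lemma target_ball_small (q : E) (e : R) (j : J) : 0 < e -> exists t : target,
  [/\ target_ball t q, forall z, target_ball t z -> nr (z - q) < e & t.2 = j].
Proof.
move=> e0; have e2 : 0 < e / 2 by rewrite divr_gt0.
have [s sP] : exists s : nat, (s.+1%:R : R)^-1 < e / 2.
  have [s _ /(_ s (leqnn _)) /= sP] := near_infty_natSinv_lt (PosNum e2).
  by exists s.
have s0 : 0 < (s.+1%:R : R)^-1 by rewrite invr_gt0.
set d := (s.+1%:R : R)^-1 in sP s0.
have rat_near (x : R) : exists y : rat, `|x - ratr y| < d / 2.
  have [|y] := @rat_in_itvoo R (x - d / 2) (x + d / 2).
    by have := s0; lra.
  rewrite in_itv /= => /andP[y1 y2]; exists y.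
  by rewrite ltr_norml; apply/andP; split; lra.
have [f fP] := choice (fun l => rat_near (complex.Re (q 0 l))).
have [g gP] := choice (fun l => rat_near (complex.Im (q 0 l))).
pose t : target := (\row_l f l, \row_l g l, s, j); exists t.
have tq : target_ball t q.
  rewrite /target_ball /= -/d; apply: nr_lt => // x l; rewrite ord1 rowBE !mxE /=.
  apply: le_lt_trans (ReIm_nr _) _.
  by have := fP l; have := gP l; case: (q 0 l) => u v /=; lra.
split => // z; rewrite /target_ball /= in tq *; rewrite -/d in tq * => zt.
rewrite (subr_mid (target_center t)); apply: le_lt_trans (nrD _ _) _.
by rewrite [nr (_ - q)]nrBC; have := e2; lra.
Qed.

(** In the second case theta is the identity, so that [A] brings every point of the
    ball from the radius r down to the trapping radius 2 c r, and the whole ball ends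
    up in the basins.  Asking for the radius r rather than 2 c r in the first case
    leaves room for the moves. *)
Definition task (theta Phi : auto R k) (t : target) :=
  (exists z, target_ball t z /\ nr (theta (Phi z) - a t.2) < r) \/
  ((theta : E -> E) = id /\
   forall z, target_ball t z -> exists i, nr (Phi z - a i) < r).

(** The moves need a point with P p_0 <> P beta.  As Phi is open and P is nowhere
    locally constant, a nearby point of the ball has this property, and half of the
    distance to the points [a i] is left. *)
Lemma step (Phi : auto R k) (t : target) : exists theta : auto R k,
  [/\ forall i, theta (a i) = a i, theta b = b, flat a 1 (2 * c * r) theta &
      task theta Phi t].
Proof.
have [[z [zt zf]]|no] := pselect (exists z, target_ball t z /\ forall i, r <= nr (Phi z - a i)).
  pose x := Phi z.
  have := differentiable_continuous (agd Phi x).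
  have tz : nbhs (ag Phi x) (target_ball t).
    rewrite /x afK; apply/nbhs_nr.
    exists ((t.1.2.+1%:R)^-1 - nr (z - target_center t)); first by rewrite subr_gt0.
    move=> y hy; rewrite /target_ball /= (subr_mid z).
    by apply: le_lt_trans (nrD _ _) _; rewrite -ltrBrDr.
  move=> /(_ _ tz) /nbhs_nr[d d0 near_d].
  have e0 : 0 < Num.min d (r / 2) by rewrite lt_min d0 divr_gt0.
  have [u [ux uP]] := Pgen (x 0 i0) e0.
  move: ux; rewrite lt_min => /andP[ud ur].
  pose y := x + axis_point i0 (u - x 0 i0).
  have yx : nr (y - x) = nr (u - x 0 i0) by rewrite /y addrC addKr nr_axis_point.
  have y0 : y 0 i0 = u by rewrite mxE axis_point_id addrC subrK.
  have [||q qj H] := @move_in t.2 y.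
  - move=> i; have := zf i; rewrite -/x (subr_mid y) => h.
    have := le_trans h (nrD _ _); rewrite [nr (x - y)]nrBC yx; lra.
  - by rewrite y0.
  have [theta [h1 h2 h3 h4]] := H 1 ltr01.
  exists theta; split => //; left; exists (ag Phi y); split.
    by apply: near_d; rewrite yx.
  by rewrite agK h4.
exists auto_id; split => //.
  move=> i s x y sr hx hy; rewrite subrr nr0 !mulr_ge0 ?nr_ge0 //.
  by apply: le_trans hx; exact: nr_ge0.
right; split => // z zt; apply: contra_notP no => no'; exists z; split => // i.
by rewrite leNgt; apply/negP => h; apply: no'; exists i.
Qed.

Lemma stage (Phi : auto R k) (n : nat) : exists theta : auto R k,
  [/\ forall i, theta (a i) = a i, theta b = b, flat a 1 (2 * c * r) theta &
      forall t, unpickle n = Some t -> task theta Phi t].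
Proof.
case: (unpickle n) => [t|].
  have [theta [h1 h2 h3 h4]] := step Phi t.
  by exists theta; split => // s [<-].
exists auto_id; split => // i s x y sr hx hy; rewrite subrr nr0 !mulr_ge0 ?nr_ge0 //.
by apply: le_trans hx; exact: nr_ge0.
Qed.

Section Dynamics.
Variables (A : auto R k) (KA : R).
Hypothesis (KA0 : 0 <= KA).
Hypothesis Aa : forall i, A (a i) = a i.
Hypothesis Ab : A b = b.
Hypothesis AP : forall i rho x y, rho <= r -> nr (x - a i) <= rho ->
  nr (y - a i) <= rho -> nr (A x - A y - c%:C *: (x - y)) <= KA * rho * nr (x - y).
Hypotheses (KAc : KA * r <= c) (r1 : r <= 1) (KAr : 20 * (4 * KA + 1) * r <= 1).

Let theta := projT1 (choice (fun Pn : auto R k * nat => stage Pn.1 Pn.2)).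
Let thetaP Phi n : [/\ forall i, theta (Phi, n) (a i) = a i, theta (Phi, n) b = b,
  flat a 1 (2 * c * r) (theta (Phi, n)) &
  forall t, unpickle n = Some t -> task (theta (Phi, n)) Phi t].
Proof.
exact: (projT2 (choice (fun Pn : auto R k * nat => stage Pn.1 Pn.2)) (Phi, n)).
Qed.

Fixpoint orbit_map n : auto R k :=
  if n is n'.+1 then
    auto_comp A (auto_comp (theta (orbit_map n', n')) (orbit_map n'))
  else auto_id.
Lemma orbit_mapS n z :
  orbit_map n.+1 z = A (theta (orbit_map n, n) (orbit_map n z)).
Proof. by []. Qed.

Let psi n z := A (theta (orbit_map n, n) z).

Let c32 : c <= 1 / 32.
Proof. have h1 := ler_wpM2r (ltW c0) L1; have := cmu; have := mu1; lra. Qed.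
Let cr : 0 < c * r. Proof. exact: mulr_gt0. Qed.
Let crr : 2 * c * r <= r / 16.
Proof. have := ler_wpM2r (ltW r_gt0) c32; lra. Qed.

Lemma orbit_map_a i n : orbit_map n (a i) = a i.
Proof.
elim: n => //= n IH; have [h _ _ _] := thetaP (orbit_map n) n.
by rewrite IH h Aa.
Qed.
Lemma orbit_map_b n : orbit_map n b = b.
Proof.
elim: n => //= n IH; have [_ h _ _] := thetaP (orbit_map n) n.
by rewrite IH h Ab.
Qed.

(** The map theta is 2-Lipschitz near the points, so the bound for [A] on the ball of
    radius 2 rho applies to its values. *)
Lemma psi_near n i rho x y : rho <= 2 * c * r ->
  nr (x - a i) <= rho -> nr (y - a i) <= rho ->
  nr (psi n x - psi n y - c%:C *: (x - y)) <= (4 * KA + c) * rho * nr (x - y).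
Proof.
move=> rr hx hy; have rho0 : 0 <= rho by apply: le_trans hx; exact: nr_ge0.
have [ta _ tf _] := thetaP (orbit_map n) n.
rewrite /psi; set th := theta _ in ta tf *.
have e1 : 1 * (2 * c * r) <= 1 by have := crr; have := r1; lra.
have ha : nr (a i - a i) <= rho by rewrite subrr nr0.
have hfx : nr (th x - a i) <= 2 * rho.
  rewrite -{1}(ta i); apply: le_trans (flat_lip tf ler01 e1 rr hx ha) _.
  by rewrite ler_pM2l.
have hfy : nr (th y - a i) <= 2 * rho.
  rewrite -{1}(ta i); apply: le_trans (flat_lip tf ler01 e1 rr hy ha) _.
  by rewrite ler_pM2l.
have r2 : 2 * rho <= r by have := crr; have := r_gt0; lra.
have h1 := AP r2 hfx hfy; have h2 := tf i _ _ _ rr hx hy.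
have h3 := flat_lip tf ler01 e1 rr hx hy.
have -> : A (th x) - A (th y) - c%:C *: (x - y) =
  (A (th x) - A (th y) - c%:C *: (th x - th y)) + c%:C *: (th x - th y - (x - y)).
  by rewrite (scalerBr _ (th x - th y)) addrA subrK.
apply: le_trans (nrD _ _) _; rewrite nrZ nr_real gtr0_norm //.
have h4 := ler_wpM2l (ltW c0) h2.
have k0 : 0 <= KA * (2 * rho) by rewrite !mulr_ge0.
have h5 := le_trans h1 (ler_wpM2l k0 h3).
apply: le_trans (lerD h5 h4) _.
by rewrite le_eqVlt; apply/orP; left; apply/eqP; ring.
Qed.

Lemma A_trap i x : nr (x - a i) < r -> nr (A x - a i) < 2 * c * r.
Proof.
move=> hx; have ha : nr (a i - a i) <= nr (x - a i) by rewrite subrr nr0 nr_ge0.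
have := AP (ltW hx) (lexx _) ha; rewrite Aa => h.
rewrite -(subrK (c%:C *: (x - a i)) (A x - a i)).
apply: le_lt_trans (nrD _ _) _; rewrite nrZ nr_real gtr0_norm //.
have N0 := nr_ge0 (x - a i).
have h1 : KA * nr (x - a i) <= c by apply: le_trans KAc; apply: ler_wpM2l => //; exact: ltW.
have h2 := ler_wpM2r N0 h1.
apply: le_lt_trans (lerD (le_trans h h2) (lexx _)) _.
have -> : c * nr (x - a i) + c * nr (x - a i) = 2 * c * nr (x - a i) by ring.
by rewrite ltr_pM2l // mulr_gt0.
Qed.

Definition Omega j := basin (a j) (2 * c * r) orbit_map.

Let cr2 : 0 < 2 * c * r. Proof. have := cr; lra. Qed.
Let c4 : c <= 1 / 4. Proof. have := c32; lra. Qed.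
Let K'0 : 0 <= 4 * KA + c.
Proof. by have := KA0; have := c0; lra. Qed.
Let K'r : (4 * KA + c) * (2 * c * r) <= c / 10.
Proof.
have h1 : 4 * KA + c <= 4 * KA + 1 by have := c32; lra.
have h2 := ler_wpM2r (ltW cr2) h1; apply: le_trans h2 _.
have h3 := ler_wpM2r (ltW c0) KAr; lra.
Qed.

(** If b is the fixed point outside the basin, it is not in the trap as |P b| is
    larger than the values of P there. *)
Lemma Omega_fb j : fatou_bieberbach (Omega j).
Proof.
have psiS n z : orbit_map n.+1 z = psi n (orbit_map n z) by [].
have FB (x : E) : (forall n, orbit_map n x = x) -> 2 * c * r <= nr (x - a j) ->
    fatou_bieberbach (Omega j).
  apply: (basin_fatou_bieberbach cr2 c0 c4 K'0 K'r psiS (orbit_map_a j)).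
  by move=> n rho y z; exact: psi_near.
have rle : 2 * c * r <= r0 by have := crr; have := rr0; have := r_gt0; lra.
have [Pb|[i ij]] := proper j; last first.
  apply: (FB (a i)); first by move=> n; exact: orbit_map_a.
  by have := dist_sep ij; have := rle; have := r00; lra.
apply: (FB b); first exact: orbit_map_b.
rewrite -axis_pointB nr_axis_point leNgt; apply/negP => h.
have [/eqP|rb'] := rb; first by rewrite (negPf Pb).
have h1 : nr (beta - alpha j) <= r0 by have := rle; lra.
have h2 : nr (alpha j - alpha j) <= r0 by rewrite subrr nr0 ltW.
have := Plip h1 h2; rewrite Pa subr0; apply/negP; rewrite -ltNge.
apply: le_lt_trans rb'; apply: ler_wpM2l; first by have := L1; lra.
by have := crr; have := r_gt0; lra.
Qed.

Lemma Omega_disj i j : i != j -> Omega i `&` Omega j = set0.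
Proof.
move=> ij; rewrite -subset0 => x [[N1 h1] [N2 h2]].
have psiS n z : orbit_map n.+1 z = psi n (orbit_map n z) by [].
have W l N M z := @trapW _ _ (a l) _ _ _ orbit_map psi cr2 c0 c4 K'0 K'r psiS (orbit_map_a l)
  (fun n rho y z => @psi_near n l rho y z) N M z.
have := W _ _ (maxn N1 N2) _ (leq_maxl _ _) h1.
have := W _ _ (maxn N1 N2) _ (leq_maxr _ _) h2.
set y := orbit_map _ x => g2; rewrite nrBC => g1.
have := dist_sep ij; apply/negP; rewrite -ltNge (subr_mid y).
by apply: le_lt_trans (nrD _ _) _; have := crr; have := rr0; have := r_gt0; lra.
Qed.

(** At the stage that treats a small ball B around q for the index j, the second
    case of [task] would trap q itself. *)
Lemma Omega_boundary q : (forall j, ~ Omega j q) -> forall j, boundary (Omega j) q.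
Proof.
move=> qO j; split; last by move=> /interior_subset; exact: qO.
move=> B /nbhs_nr[e e0 eB].
have [t [tq tB tj]] := target_ball_small q j e0.
pose n := pickle t.
have [_ _ _ /(_ t)] := thetaP (orbit_map n) n; rewrite pickleK => /(_ erefl).
move: (theta _) (orbit_mapS n) => th orbit_mapS.
move=> [[z [zt zj]]|[tid tall]].
  exists z; split; last by apply: eB; exact: tB.
  by exists n.+1; rewrite -tj orbit_mapS; exact: A_trap zj.
have [i hi] := tall _ tq; exfalso; apply: (qO i); exists n.+1.
by rewrite orbit_mapS tid; exact: A_trap hi.
Qed.
End Dynamics.
End Radius.

(** The contraction factor c is chosen first, small with respect to the ratio of
    the lower and upper bounds of P, then the radius r. *)
Theorem common_boundary : exists Omega : J -> set E,
  [/\ forall j, fatou_bieberbach (Omega j),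
      forall i j, i != j -> Omega i `&` Omega j = set0 &
      forall q, (forall j, ~ Omega j q) -> forall j, boundary (Omega j) q].
Proof.
have L0 : 0 < L by have := L1; lra.
pose c := mu / (32 * L).
have c0 : 0 < c by rewrite divr_gt0 // mulr_gt0.
have cmu : 32 * L * c <= mu by rewrite /c mulrC divfK // gt_eqF // mulr_gt0.
have c1 : c <= 1.
  have h1 := ler_wpM2r (ltW c0) L1; have := cmu; have := mu1; have := c0; lra.
have [A [AQ [KA [rA [KA0 rA0 AP]]]]] := @contracting_auto R k J i0 i1 alpha Q c K r0 i01 c0 c1 K0 r00 dQ Qa Qlip.
(* For r <= rb, the values of P on the discs around the points alpha are smaller
   than |P beta|. *)
pose rb : R := if P beta == 0 then 1 else nr (P beta) / (2 * L).
have rb0 : 0 < rb.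
  rewrite /rb; case: ifPn => // Pb; rewrite divr_gt0 ?mulr_gt0 //.
  by rewrite lt_def nr_eq0 Pb nr_ge0.
have KA1 : 0 < KA + 1 by rewrite ltr_wpDl.
have KA2 : 0 < 20 * (4 * KA + 1) by rewrite mulr_gt0 // ltr_wpDl // mulr_ge0.
pose r := Num.min (Num.min (Num.min r0 rA) (Num.min rb 1))
  (Num.min (c / (KA + 1)) (20 * (4 * KA + 1))^-1).
have r_gt0 : 0 < r.
  by rewrite !lt_min r00 rA0 rb0 ltr01 divr_gt0 // invr_gt0 KA2.
have : r <= r by []. rewrite {2}/r !le_min.
move=> /andP[/andP[/andP[rr0 rrA] /andP[rrb r1]] /andP[rc rK]].
have rbP : P beta = 0 \/ L * r < nr (P beta).
  have [|Pb] := eqVneq (P beta) 0; [by left|right].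
  have nPb : 0 < nr (P beta) by rewrite lt_def nr_eq0 Pb nr_ge0.
  move: rrb; rewrite /rb (negPf Pb) ler_pdivlMr ?mulr_gt0 //.
  have := mulr_gt0 L0 r_gt0; lra.
have KAc : KA * r <= c.
  move: rc; rewrite ler_pdivlMr //; lra.
have KAr : 20 * (4 * KA + 1) * r <= 1.
  by rewrite -ler_pdivlMl // mulr1.
have Aa i : A (a i) = a i by apply: AQ; exact: Qa.
have Ab : A b = b by exact: AQ.
have AP' i rho x y : rho <= r -> nr (x - a i) <= rho -> nr (y - a i) <= rho ->
   nr (A x - A y - c%:C *: (x - y)) <= KA * rho * nr (x - y).
  move=> h1 h2 h3; rewrite -mul_mx_scalar; apply: (AP i) => //.
  exact: le_trans rrA.
exists (Omega c0 cmu r_gt0 rr0 rbP A); split.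
- by move=> j; apply: (@Omega_fb _ _ c0 cmu r_gt0 rr0 rbP A KA).
- by move=> i j ij; apply: (@Omega_disj _ _ c0 cmu r_gt0 rr0 rbP A KA).
- by move=> q qO j; apply: (@Omega_boundary _ _ c0 cmu r_gt0 rr0 rbP A KA).
Qed.
End Construction.

(** * Finitely many domains: polynomials *)

Section Polynomials.
Context {R : realType}.
Local Notation C := R[i].
Implicit Types p : {poly C}.

(** The bounds for polynomials are uniform on a disc, hence uniform over finitely
    many points. *)
Lemma horner_lip p (B : R) : 0 <= B -> exists2 K : R, 0 <= K &
  forall x y, nr x <= B -> nr y <= B -> nr (p.[x] - p.[y]) <= K * nr (x - y).
Proof.
move=> B0; elim/poly_ind: p => [|p c [K K0 KP]].
  by exists 0 => // x y _ _; rewrite !horner0 subrr nr0 mul0r.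
exists (K * B + (nr p.[0] + K * B)).
  by rewrite !addr_ge0 ?nr_ge0 // mulr_ge0.
move=> x y hx hy; rewrite !hornerMXaddC.
have -> : p.[x] * x + c - (p.[y] * y + c) = (p.[x] - p.[y]) * x + p.[y] * (x - y) by ring.
apply: le_trans (nrD _ _) _; rewrite !nrM.
have h1 := KP _ _ hx hy.
have h2 : nr p.[y] <= nr p.[0] + K * B.
  rewrite -(subrK p.[0] p.[y]) addrC; apply: le_trans (nrD _ _) _.
  rewrite lerD2l; have := KP y 0 hy; rewrite nr0 subr0 => /(_ B0) h.
  by apply: le_trans h _; apply: ler_wpM2l.
have h3 := ler_pM (nr_ge0 _) (nr_ge0 _) h1 hx.
have h4 := ler_wpM2r (nr_ge0 (x - y)) h2.
apply: le_trans (lerD h3 h4) _.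
by rewrite le_eqVlt; apply/orP; left; apply/eqP; ring.
Qed.

Lemma horner_bound p (B : R) : 0 <= B -> exists2 K : R, 0 <= K &
  forall x, nr x <= B -> nr p.[x] <= K.
Proof.
move=> B0; have [K K0 KP] := horner_lip p B0.
exists (nr p.[0] + K * B); first by rewrite addr_ge0 ?nr_ge0 ?mulr_ge0.
move=> x hx; rewrite -(subrK p.[0] p.[x]) addrC; apply: le_trans (nrD _ _) _.
rewrite lerD2l; have := KP x 0 hx; rewrite nr0 subr0 => /(_ B0) h.
by apply: le_trans h _; apply: ler_wpM2l.
Qed.

Lemma horner_quad p (B : R) : 0 <= B -> exists2 K : R, 0 <= K &
  forall a rho x y, nr a <= B -> nr x <= B -> nr y <= B ->
  nr (x - a) <= rho -> nr (y - a) <= rho ->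
  nr (p.[x] - p.[y] - p^`().[a] * (x - y)) <= K * rho * nr (x - y).
Proof.
move=> B0; elim/poly_ind: p => [|p c [K K0 KP]].
  by exists 0 => // *; rewrite deriv0 !horner0 subrr mul0r subrr nr0 !mul0r.
have [K1 K10 KP1] := horner_lip p B0.
have [K2 K20 KP2] := horner_bound p^`() B0.
exists (K * B + K1 + K2); first by rewrite !addr_ge0 // mulr_ge0.
move=> a rho x y ha hx hy xa ya.
have rho0 : 0 <= rho by apply: le_trans xa; exact: nr_ge0.
rewrite derivD derivM derivX derivC addr0 mulr1 !hornerMXaddC hornerD hornerMX.
have -> : p.[x] * x + c - (p.[y] * y + c) - (p^`().[a] * a + p.[a]) * (x - y) =
  (p.[x] - p.[y] - p^`().[a] * (x - y)) * x + (p.[y] - p.[a]) * (x - y) +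
  p^`().[a] * (x - a) * (x - y) by ring.
apply: le_trans (nrD _ _) _; apply: le_trans (lerD (nrD _ _) (lexx _)) _.
rewrite !nrM.
have h1 := ler_pM (nr_ge0 _) (nr_ge0 _) (KP _ _ _ _ ha hx hy xa ya) hx.
have h2 := le_trans (KP1 _ _ hy ha) (ler_wpM2l K10 ya).
have h3 := ler_pM (nr_ge0 _) (nr_ge0 _) (KP2 _ ha) xa.
have N0 := nr_ge0 (x - y).
have h4 := ler_wpM2r N0 h2; have h5 := ler_wpM2r N0 h3.
apply: le_trans (lerD (lerD h1 h4) h5) _.
by rewrite le_eqVlt; apply/orP; left; apply/eqP; ring.
Qed.

Lemma horner_diff p (x : C) : differentiable (fun t : C => p.[t]) x.
Proof.
elim/poly_ind: p => [|p c IH].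
  have -> : (fun t : C => (0 : {poly C}).[t]) = cst 0 by apply/funext => t; rewrite horner0.
  exact: differentiable_cst.
have -> : (fun t : C => (p * 'X + c%:P).[t]) = (fun t : C => p.[t]) * id + cst c.
  by apply/funext => t; rewrite hornerMXaddC.
move: (fun t : C => p.[t]) IH => f df.
have dm : differentiable (f * id) x by exact: differentiableM.
have dc : differentiable (cst c : C -> C) x by exact: differentiable_cst.
exact: differentiableD dm dc.
Qed.

(** Otherwise p - c would have too many roots of the form x + e / (n + 2). *)
Lemma horner_nonconst p (x c : C) (e : R) : (1 < size p)%N -> 0 < e ->
  exists u, nr (u - x) < e /\ p.[u] != c.
Proof.
move=> sp e0; apply: contrapT => no.
pose s (n : nat) : C := x + (e / n.+2%:R)%:C.
pose rs := [seq s n | n <- iota 0 (size p)].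
have pc : size (p - c%:P) = size p.
  by rewrite size_polyDl // size_polyN (leq_ltn_trans (size_polyC_leq1 _)).
have p0 : p - c%:P != 0 by rewrite -size_poly_eq0 pc -lt0n (ltn_trans _ sp).
have := max_poly_roots (rs := rs) p0; rewrite pc size_map size_iota ltnn.
suff [h1 h2] : all (root (p - c%:P)) rs /\ uniq rs by move=> /(_ h1 h2).
split.
  apply/allP => _ /mapP[n _ ->]; rewrite rootE !hornerE subr_eq0.
  apply: contrapT => h; apply: no; exists (s n); split; last exact/negP.
  rewrite /s addrC addKr nr_real ger0_norm; last by rewrite divr_ge0 // ltW.
  by rewrite ltr_pdivrMr // ltr_pMr // ltr1n.
rewrite map_inj_uniq ?iota_uniq // => n n' /addrI /complexI /(mulfI (lt0r_neq0 e0)).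
by move=> /invr_inj /eqP; rewrite eqr_nat => /eqP [].
Qed.

(** Here alpha_i = i + 1 and P is the product of the X - alpha_i.  The roots of p0
    are 0 and the alpha_i; as p0 is separable, u p0 + v p0' = 1, and q = v p0
    vanishes at these roots with derivative 1.  The extra root 0 gives the fixed point
    outside all the basins. *)
Lemma finite_common_boundary (k m : nat) (i0 i1 : 'I_k) : i0 != i1 ->
  exists Omega : 'I_m.+1 -> set 'rV[C]_k,
  [/\ forall j, fatou_bieberbach (Omega j),
      forall i j, i != j -> Omega i `&` Omega j = set0 &
      forall q, (forall j, ~ Omega j q) -> forall j, boundary (Omega j) q].
Proof.
move=> i01; pose alpha (i : 'I_m.+1) : C := i.+1%:R.
pose p := \prod_(i < m.+1) ('X - (alpha i)%:P).
have pE z : p.[z] = \prod_(i < m.+1) (z - alpha i).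
  by rewrite horner_prod; apply: eq_bigr => i _; rewrite !hornerE.
pose rs : seq C := [seq n%:R | n <- iota 0 m.+2].
pose p0 := \prod_(z <- rs) ('X - z%:P).
have rs_uniq : uniq rs.
  by rewrite map_inj_uniq ?iota_uniq // => x y /eqP; rewrite eqr_nat => /eqP.
have : separable_poly p0 by rewrite separable_prod_XsubC.
rewrite unlock => /Bezout_eq1_coprimepP[[u v] /= uv].
pose q := v * p0.
have p0_root (z : C) : z \in rs -> p0.[z] = 0.
  by move=> zr; apply/eqP; rewrite -rootE root_prod_XsubC.
have q_root z : z \in rs -> q.[z] = 0.
  by move=> zr; rewrite hornerM p0_root // mulr0.
have q_deriv z : z \in rs -> q^`().[z] = 1.
  move=> zr; have := congr1 (fun f : {poly C} => f.[z]) uv.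
  by rewrite derivM !hornerE p0_root // !mulr0 !add0r.
have alpha_rs i : alpha i \in rs.
  by apply/mapP; exists i.+1 => //; rewrite mem_iota /= add0n ltnS ltn_ord.
have zero_rs : 0 \in rs by apply/mapP; exists 0%N.
have nrn (n : nat) : nr (n%:R : C) = n%:R.
  by rewrite -(rmorph_nat (real_complex R)) nr_real ger0_norm.
pose B : R := m.+2%:R.
have B0 : 0 <= B by [].
have alphaB i : nr (alpha i) + 1 <= B.
  by rewrite /alpha nrn natr1 ler_nat !ltnS -ltnS.
have nearB i x (rho : R) : rho <= 1/2 -> nr (x - alpha i) <= rho -> nr x <= B.
  move=> h1 h2; rewrite -(subrK (alpha i) x); apply: le_trans (nrD _ _) _.
  by have := alphaB i; lra.
have alB i : nr (alpha i) <= B by have := alphaB i; lra.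
have [L L0 LP] := horner_lip p B0.
have [K K0 KP] := horner_quad q B0.
have sep1 i j : i != j -> 1 <= nr (alpha i - alpha j).
  have wl (x y : nat) : (x < y)%N -> 1 <= nr (y%:R - x%:R : C).
    by move=> xy; rewrite -natrB ?nrn ?ler1n ?subn_gt0 // ltnW.
  rewrite -(inj_eq val_inj) neq_ltn /alpha => /orP[h|h]; last exact: wl.
  by rewrite nrBC; exact: wl.
have mu0 : 0 < (2^-1 : R) ^+ m by rewrite exprn_gt0 // invr_gt0.
apply: (@common_boundary R k _ i0 i1 alpha 0 (fun z => p.[z]) (fun z => q.[z])
  (1/2) (L + 1) (2^-1 ^+ m) K i01) => //.
- by move=> t; exact: horner_diff.
- by move=> t; exact: horner_diff.
- by rewrite lerDr.
- by rewrite exprn_ile1 // ?invr_ge0 // invf_le1 // ler1n.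
- by move=> i j /sep1; lra.
- by move=> i; rewrite pE (bigD1 i) //= subrr mul0r.
- move=> i t w ht hw; apply: le_trans (LP _ _ (nearB _ _ _ _ ht) (nearB _ _ _ _ hw)) _ => //.
  by rewrite ler_wpM2r ?nr_ge0 // lerDl.
- move=> rho z rho0 rho2 h.
  have [i hi] : exists i, forall j, j != i -> 2^-1 <= nr (z - alpha j).
    have [[i hi]|no] := pselect (exists i, nr (z - alpha i) < 2^-1); last first.
      by exists ord0 => j _; rewrite leNgt; apply/negP => hj; apply: no; exists j.
    exists i => j ji; have := sep1 _ _ ji; rewrite (subr_mid z) => h1.
    have := le_trans h1 (nrD _ _); rewrite [nr (alpha j - z)]nrBC; lra.
  have nr_prod (S : pred 'I_m.+1) (F : 'I_m.+1 -> C) :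
      nr (\prod_(j | S j) F j) = \prod_(j | S j) nr (F j).
    by elim/big_rec2 : _ => [|j x y _ <-]; rewrite ?nr1 // nrM.
  rewrite pE (bigD1 i) //= nrM nr_prod mulrC.
  apply: ler_pM; [exact: ltW|exact: ltW|exact: h|].
  have -> : (2^-1 : R) ^+ m = \prod_(j < m.+1 | j != i) 2^-1.
    by rewrite prodr_const cardC1 card_ord.
  by apply: ler_prod => j ji; rewrite hi // invr_ge0 ler0n.
- move=> t e e0; apply: horner_nonconst => //.
  by rewrite /p -big_enum size_prod_XsubC -cardE card_ord.
- by move=> i; exact: q_root.
- exact: q_root.
- move=> i rho t w rho2 ht hw.
  have := KP (alpha i) rho t w (alB i) (nearB _ _ _ rho2 ht) (nearB _ _ _ rho2 hw) ht hw.
  by rewrite q_deriv // mul1r.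
- move=> j; left; rewrite pE; apply/prodf_neq0 => i _.
  by rewrite sub0r oppr_eq0 pnatr_eq0.
Qed.
End Polynomials.

(** * Infinitely many domains: the exponential *)

Section RealEstimates.
Context {R : realType}.
Implicit Types x y : R.

Lemma sin_mvt y : exists2 u, `|u| <= `|y| & sin y = cos u * y.
Proof.
have pos (z : R) : 0 <= z -> exists2 u, `|u| <= `|z| & sin z = cos u * z.
  move=> z0; have [|u] := @MVT_segment R sin cos 0 z z0.
    by apply: continuous_subspaceT => x; exact: continuous_sin.
  rewrite in_itv /= => /andP[u0 uz]; rewrite sin0 !subr0 => h.
  by exists u; rewrite ?ger0_norm.
have [/pos//|y0] := leP 0 y.
have [|u h1 h2] := pos (- y); first by rewrite oppr_ge0 ltW.
exists u; first by rewrite -(normrN y).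
by apply: oppr_inj; rewrite -sinN h2 mulrN.
Qed.

Lemma sin_le_norm y : `|sin y| <= `|y|.
Proof.
by have [u _ ->] := sin_mvt y; rewrite normrM ler_piMl // cos_max.
Qed.

(** By the mean value theorem cos y - 1 = - y sin u with |sin u| <= |u| <= |y|. *)
Lemma cos_near1 y : `|cos y - 1| <= y ^+ 2.
Proof.
have pos (z : R) : 0 <= z -> `|cos z - 1| <= z ^+ 2.
  move=> z0; have [|u] := @MVT_segment R cos (fun x => - sin x) 0 z z0.
    by apply: continuous_subspaceT => x; exact: continuous_cos.
  rewrite in_itv /= => /andP[u0 uz]; rewrite cos0 !subr0 => ->.
  rewrite normrM normrN expr2 (ger0_norm z0) ler_wpM2r //.
  by apply: le_trans (sin_le_norm _) _; rewrite ger0_norm.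
by have [/pos//|y0] := leP 0 y; rewrite -cosN -sqrrN pos // oppr_ge0 ltW.
Qed.

Lemma sin_near y : `|y| <= 1 -> `|sin y - y| <= y ^+ 2.
Proof.
move=> y1; have [u uy ->] := sin_mvt y.
rewrite -{2}[y]mul1r -mulrBl normrM.
have h : `|cos u - 1| <= `|y|.
  apply: le_trans (cos_near1 _) _; rewrite -real_normK ?num_real // expr2.
  by rewrite -[leRHS]mulr1; apply: ler_pM => //; exact: le_trans y1.
by rewrite -(real_normK (num_real y)) expr2 ler_wpM2r.
Qed.

Lemma expR_bounds x : `|x| <= 1/2 ->
  [/\ expR x <= 2, `|expR x - 1| <= 2 * `|x| & `|expR x - 1 - x| <= 2 * x ^+ 2].
Proof.
move=> xh; have h0 := expR_gt0 x; have h1 := expR_ge1Dx x.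
have h2 : expR x * (1 - x) <= 1.
  have := expR_ge1Dx (- x); rewrite expRN => h.
  by have := ler_wpM2l (ltW h0) h; rewrite mulfV ?gt_eqF.
have [xl xu] : - (1/2) <= x /\ x <= 1/2 by move: xh; rewrite ler_norml => /andP[].
have e2 : expR x <= 2.
  have := ler_wpM2l (ltW h0) xu; lra.
have e1 : `|expR x - 1| <= 2 * `|x|.
  have [x0|x0] := leP 0 x.
    have := ler_wpM2r x0 e2; rewrite (ger0_norm x0) ler_norml => h.
    by apply/andP; split; lra.
  rewrite (ltr0_norm x0) ler_norml; apply/andP; split; first by lra.
  have : expR x * x <= 0 by rewrite mulr_ge0_le0 // ltW.
  lra.
split => //; rewrite ger0_norm; last by lra.
have : x * (expR x - 1) <= 2 * x ^+ 2.
  apply: le_trans (ler_norm _) _; rewrite normrM.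
  apply: le_trans (ler_wpM2l (normr_ge0 x) e1) _.
  by rewrite mulrCA -expr2 real_normK ?num_real.
rewrite mulrBr mulr1; lra.
Qed.

(** By the mean value theorem sin y = y cos u with |u| <= |y|, and the cosine
    decreases on [0, pi]. *)
Lemma small_angle y (s : R) : `|y| <= pi -> `|sin y| <= s -> 1/2 <= cos y ->
  `|y| <= 2 * s.
Proof.
move=> ypi sy cy; have [u uy yE] := sin_mvt y.
have cu : 1/2 <= cos u.
  apply: le_trans cy _; rewrite -cos_norm -[leRHS]cos_norm.
  have [->//|ne] := eqVneq `|u| `|y|.
  rewrite ltW // ltr_cos ?in_itv //= ?normr_ge0 ?(le_trans uy) //.
  by rewrite lt_neqAle ne.
move: sy; rewrite yE normrM => h.
have := ler_wpM2r (normr_ge0 y) (le_trans cu (ler_norm _)); lra.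
Qed.
End RealEstimates.

Section Exponential.
Context {R : realType}.
Local Notation C := R[i].
Implicit Types z w : C.

Definition cexp z : C :=
  (expR (complex.Re z) * cos (complex.Im z)) +i*
  (expR (complex.Re z) * sin (complex.Im z)).

Lemma cexpD z w : cexp (z + w) = cexp z * cexp w.
Proof.
rewrite /cexp !raddfD /= expRD cosD sinD.
by apply/eqP; rewrite eq_complex /=; apply/andP; split; apply/eqP; ring.
Qed.

Lemma nr_sqr z : nr z ^+ 2 = complex.Re z ^+ 2 + complex.Im z ^+ 2.
Proof. by apply: (@complexI R); rewrite rmorphXn /= -nrE add_Re2_Im2. Qed.

Lemma nr_cexp z : nr (cexp z) = expR (complex.Re z).
Proof.
apply/eqP; rewrite -(@eqrXn2 _ 2) ?nr_ge0 ?expR_ge0 // nr_sqr /=.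
by rewrite !exprMn -mulrDr cos2Dsin2 mulr1.
Qed.

Lemma cexp_quad w : nr w <= 1/2 -> nr (cexp w - 1 - w) <= 4 * nr w ^+ 2.
Proof.
move=> h; have hx := le_trans (Re_nr w) h; have hy := le_trans (Im_nr w) h.
apply: le_trans (ReIm_nr _) _; rewrite nr_sqr !raddfB /= subr0.
move: (complex.Re w) (complex.Im w) hx hy => x y hx hy.
have [e2 e1 e0] := expR_bounds hx.
have hy1 : `|y| <= 1 by lra.
have g1 : `|expR x * cos y - 1 - x| <= 2 * x ^+ 2 + 2 * y ^+ 2.
  have -> : expR x * cos y - 1 - x = (expR x - 1 - x) + expR x * (cos y - 1) by ring.
  apply: le_trans (ler_normD _ _) _; apply: lerD => //.
  rewrite normrM (ger0_norm (expR_ge0 x)); apply: ler_pM => //.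
  exact: cos_near1.
have g2 : `|expR x * sin y - y| <= 2 * (`|x| * `|y|) + y ^+ 2.
  have -> : expR x * sin y - y = (expR x - 1) * sin y + (sin y - y) by ring.
  apply: le_trans (ler_normD _ _) _; apply: lerD; last exact: sin_near.
  by rewrite normrM mulrA; apply: ler_pM => //; exact: sin_le_norm.
have g3 : 2 * (`|x| * `|y|) <= x ^+ 2 + y ^+ 2.
  rewrite -(real_normK (num_real x)) -(real_normK (num_real y)).
  by have := sqr_ge0 (`|x| - `|y|); rewrite sqrrB -mulr_natl; lra.
have := sqr_ge0 x; have := sqr_ge0 y; lra.
Qed.

(** By the addition formula the expansion at 0 gives the one at z. *)
Lemma cexp_diff z : differentiable cexp z.
Proof.
apply/differentiable_nrP.
exists (GRing.scale (cexp z) : {linear C -> C}).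
  by exists (nr (cexp z)) => h; rewrite nrZ.
move=> e e0; have E0 : 0 < nr (cexp z) by rewrite nr_cexp expR_gt0.
exists (Num.min (1/2) (e / (4 * nr (cexp z)))).
  by rewrite lt_min !divr_gt0 // mulr_gt0.
move=> y; rewrite lt_min => /andP[h1 h2]; rewrite ltr_pdivlMr ?mulr_gt0 // in h2.
have -> : cexp y - cexp z - cexp z *: (y - z) = cexp z * (cexp (y - z) - 1 - (y - z)).
  have -> : cexp y = cexp z * cexp (y - z) by rewrite -cexpD addrC subrK.
  by rewrite -[_ *: _]/(_ * _); ring.
rewrite nrM; have h3 := cexp_quad (ltW h1).
apply: le_trans (ler_wpM2l (ltW E0) h3) _.
have := ler_wpM2r (nr_ge0 (y - z)) (ltW h2); rewrite expr2; lra.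
Qed.

Definition period (n : int) : C := 0 +i* (pi *+ 2 * n%:~R).

Lemma periodB n m : period n - period m = period (n - m).
Proof.
apply/eqP; rewrite eq_complex /= subr0 eqxx /=.
by rewrite rmorphB /= mulrBr.
Qed.

Lemma cexp_period n : cexp (period n) = 1.
Proof.
have pos (m : nat) : cos ((pi *+ 2 : R) * m%:R) = 1 /\ sin ((pi *+ 2 : R) * m%:R) = 0.
  rewrite mulr_natr -[_ *+ m]add0r.
  by rewrite (periodicn (@cosD2pi R)) (periodicn (@sinD2pi R)) cos0 sin0.
rewrite /cexp /= expR0 !mul1r; case: n => m.
  by rewrite -pmulrn; have [-> ->] := pos m.
rewrite NegzE mulrNz mulrN cosN sinN -pmulrn; have [-> ->] := pos m.+1.
by rewrite oppr0.
Qed.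

Lemma cexpB_period z n : cexp (z - period n) = cexp z.
Proof. by have := cexpD (z - period n) (period n); rewrite subrK cexp_period mulr1. Qed.

Lemma nr_period n : nr (period n) = pi *+ 2 * `|n|%:~R.
Proof.
apply/eqP; rewrite -(@eqrXn2 _ 2) ?nr_ge0 //; last first.
  by apply: mulr_ge0; [rewrite mulrn_wge0 ?pi_ge0|rewrite ler0z].
rewrite nr_sqr /= expr0n /= add0r !exprMn intr_norm.
by rewrite real_normK // num_real.
Qed.

Lemma cexp_lin n (rho : R) t u : rho <= 1/4 -> nr (t - period n) <= rho ->
  nr (u - period n) <= rho ->
  nr (cexp t - 1 - (cexp u - 1) - (t - u)) <= 21 * rho * nr (t - u).
Proof.
move=> r4; rewrite -(cexpB_period t n) -(cexpB_period u n).
have -> : t - u = (t - period n) - (u - period n) by rewrite opprB addrA subrK.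
move: (t - period n) (u - period n) => {}t {}u ht hu.
have tu : nr (t - u) <= 2 * rho by apply: le_trans (nrB _ _) _; lra.
have rho0 : 0 <= rho by apply: le_trans ht; exact: nr_ge0.
have N0 := nr_ge0 (t - u).
have u2 : nr u <= 1/2 by lra.
have hu0 : nr (cexp u - 1) <= 2 * rho.
  have := cexp_quad u2; rewrite -{2}(subrK u (cexp u - 1)) => h.
  apply: le_trans (nrD _ _) _.
  have h1 := ler_pM (nr_ge0 u) (nr_ge0 u) hu hu.
  have h2 := ler_wpM2r rho0 r4; rewrite expr2 in h; lra.
have hu1 : nr (cexp u) <= 2.
  rewrite -(subrK 1 (cexp u)); apply: le_trans (nrD _ _) _; rewrite nr1; lra.
have -> : cexp t - 1 - (cexp u - 1) - (t - u) =
    cexp u * (cexp (t - u) - 1 - (t - u)) + (cexp u - 1) * (t - u).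
  have -> : cexp t = cexp u * cexp (t - u) by rewrite -cexpD addrC subrK.
  by ring.
apply: le_trans (nrD _ _) _; rewrite !nrM.
have h1 : nr (t - u) <= 1/2 by lra.
have h2 := ler_pM (nr_ge0 _) (nr_ge0 _) hu1 (cexp_quad h1).
have h3 := ler_wpM2r N0 hu0; have h4 := ler_wpM2r N0 tu.
rewrite expr2 in h2; have := mulr_ge0 rho0 N0; lra.
Qed.

(** Subtracting a period, assume that the imaginary part of w is at most pi in
    absolute value.  If exp w is close to 1, then so is its modulus exp (Re w), and
    the angle Im w is close to 0. *)
Lemma cexp_low (rho : R) z : 0 < rho -> rho <= 1/4 ->
  (forall n, rho <= nr (z - period n)) -> 1/8 * rho <= nr (cexp z - 1).
Proof.
move=> rho0 rho4 h; rewrite leNgt; apply/negP => lt.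
pose n := Num.floor (complex.Im z / (pi *+ 2) + 1/2).
have pi2 : 0 < pi *+ 2 :> R by rewrite mulrn_wgt0 // pi_gt0.
have := h n; rewrite -(cexpB_period z n) in lt *.
have Iw : `|complex.Im (z - period n)| <= pi.
  have := floor_itv (complex.Im z / (pi *+ 2) + 1/2); rewrite -/n rmorphD /=.
  have yE : complex.Im z = pi *+ 2 * (complex.Im z / (pi *+ 2)).
    by rewrite mulrC divfK // gt_eqF.
  rewrite raddfB /= {3}yE -mulrBr normrM (gtr0_norm pi2).
  move: (_ / (pi *+ 2)) => q.
  move=> /andP[a1 a2].
  have piE : (pi : R) = pi *+ 2 * (1/2) by rewrite -mulr_natl; field.
  by rewrite [leRHS]piE ler_wpM2l ?(ltW pi2) // ler_norml; apply/andP; split; lra.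
move: (z - period n) lt Iw => w lt Iw; apply/negP; rewrite -ltNge.
apply: le_lt_trans (ReIm_nr w) _.
have hr := le_lt_trans (Re_nr (cexp w - 1)) lt.
have hi := le_lt_trans (Im_nr (cexp w - 1)) lt.
rewrite !raddfB /= subr0 in hr hi.
have Ew : `|expR (complex.Re w) - 1| < 1/8 * rho.
  apply: le_lt_trans lt; rewrite -nr_cexp ler_norml; apply/andP; split.
    have := nrB (cexp w) (cexp w - 1); rewrite subKr nr1; lra.
  have := nrD (cexp w - 1) 1; rewrite subrK nr1; lra.
move: (complex.Re w) (complex.Im w) Iw hr hi Ew => x y Iw hr hi Ew.
have e0 := expR_gt0 x.
move: hr hi Ew; rewrite !ltr_norml => /andP[r1 r2] /andP[i1 i2] /andP[e1 e2].
have cy : 1/2 <= cos y.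
  rewrite leNgt; apply/negP => c2.
  by have := ltr_pM2l e0 (cos y) (1/2); rewrite c2; lra.
have sy : `|sin y| <= 1/4 * rho.
  rewrite ler_norml; apply/andP; split; rewrite leNgt; apply/negP => c2.
    by have := ltr_pM2l e0 (sin y) (- (1/4 * rho)); rewrite c2; nra.
  by have := ltr_pM2l e0 (1/4 * rho) (sin y); rewrite c2; nra.
have ya := small_angle Iw sy cy.
have h1 := expR_ge1Dx x.
have xa : `|x| <= 1/4 * rho.
  rewrite ler_norml; apply/andP; split; last by lra.
  have := expR_ge1Dx (- x); rewrite expRN => h2.
  have := ler_wpM2l (ltW e0) h2; rewrite mulfV ?gt_eqF // => h3.
  rewrite leNgt; apply/negP => c2; nra.
lra.
Qed.

(** The point b is the attracting point of index 0; each basin misses another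
    attracting point. *)
Lemma infinite_common_boundary (k : nat) (i0 i1 : 'I_k) : i0 != i1 ->
  exists Omega : int -> set 'rV[C]_k,
  [/\ forall j, fatou_bieberbach (Omega j),
      forall i j, i != j -> Omega i `&` Omega j = set0 &
      forall q, (forall j, ~ Omega j q) -> forall j, boundary (Omega j) q].
Proof.
move=> i01; pose P z := cexp z - 1.
have dP z : differentiable P z.
  have dc : differentiable (cst 1 : C -> C) z by exact: differentiable_cst.
  exact: differentiableB (cexp_diff z) dc.
have Pp n : P (period n) = 0 by rewrite /P cexp_period subrr.
have P0 : P 0 = 0 by have := Pp 0; rewrite /period mulr0.
apply: (@common_boundary R k int i0 i1 period 0 P P (1/4) 8 (1/8) 21 i01) => //.
- lra.
- lra.
- move=> n m nm; rewrite periodB nr_period.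
  have h1 : (1 : R) <= `|n - m|%:~R.
    by rewrite -[1]/(1%:~R) ler_int -gtz0_ge1 normr_gt0 subr_eq0.
  have h2 := @pi_ge2 R.
  have h3 : (1 : R) <= pi *+ 2 by rewrite -mulr_natl; lra.
  by have := ler_pM ler01 ler01 h3 h1; lra.
- move=> n t u ht hu; have := cexp_lin (lexx _) ht hu => h.
  rewrite -(subrK (t - u) (P t - P u)); apply: le_trans (nrD _ _) _.
  have := nr_ge0 (t - u); rewrite /P; lra.
- exact: cexp_low.
- move=> t e e0.
  pose d := Num.min e (1/4); pose u (s : R) := t + s%:C.
  have d0 : 0 < d by rewrite lt_min e0 divr_gt0.
  have near0 (s : R) : 0 < s -> s < d -> nr (u s - t) < e.
    move=> s0 sd; rewrite /u addrC addKr nr_real gtr0_norm //.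
    by apply: lt_le_trans sd _; rewrite /d ge_min lexx.
  have [Pu|Pu] := eqVneq (P (u (d / 2))) 0; last first.
    by exists (u (d / 2)); split; [apply: near0; lra|rewrite P0].
  exists (u (d / 3)); split; first by apply: near0; lra.
  rewrite P0; apply/eqP => Pu3.
  have E1 : expR (complex.Re t + d / 2) = 1.
    by move: Pu => /subr0_eq /(congr1 nr); rewrite nr_cexp nr1 /u raddfD.
  have E2 : expR (complex.Re t + d / 3) = 1.
    by move: Pu3 => /subr0_eq /(congr1 nr); rewrite nr_cexp nr1 /u raddfD.
  have := @expR_inj R _ _ (etrans E1 (esym E2)); lra.
- by move=> n rho t u r4 ht hu; exact: (cexp_lin r4 ht hu).
- move=> n; right; exists (n + 1).
  by rewrite -subr_eq0 addrC addKr.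
Qed.
End Exponential.

(** * Fatou-Bieberbach domains with a common boundary *)

Lemma int_enum : exists2 f : nat -> int, injective f & forall n, exists j, f j = n.
Proof.
exists (fun j => if odd j then Negz j./2 else Posz j./2).
  move=> x y; case: ifP => ox; case: ifP => oy // [] xy.
    by rewrite -(odd_double_half x) -(odd_double_half y) ox oy xy.
  by rewrite -(odd_double_half x) -(odd_double_half y) ox oy xy.
case=> n; [exists n.*2|exists n.*2.+1].
  by rewrite odd_double doubleK.
by rewrite /= odd_double /= uphalf_double.
Qed.

Theorem theorem1 (R : realType) (k : nat) (hk : (2 <= k)%N)
    (m : option nat) (hm : m <> Some 0%N) :
  exists Omega : nat -> set 'rV[R[i]]_k,
    [/\ forall j, indices m j -> fatou_bieberbach (Omega j),
        forall i l, indices m i -> indices m l -> i <> l ->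
          Omega i `&` Omega l = set0
      & forall q, (~` \bigcup_(j in indices m) Omega j) q ->
          forall i, indices m i -> boundary (Omega i) q].
Proof.
have i01 : Ordinal (ltn_trans (ltnSn 0) hk) != Ordinal hk by [].
case: m hm => [[|m]|] // _.
  have [W [W1 W2 W3]] := @finite_common_boundary R k m _ _ i01.
  exists (fun j => W (inord j.-1)); split.
  - by move=> j _; exact: W1.
  - move=> i l; rewrite /indices /= => /andP[i0 im] /andP[l0 lm] il; apply: W2.
    apply/eqP => /(congr1 val) /=; rewrite !inordK ?prednK // => /(congr1 succn).
    by rewrite !prednK.
  - move=> q qW i _; apply: W3 => j Wj; apply: qW; exists j.+1 => /=.
      by rewrite /indices /= ltn_ord.
    by rewrite inord_val.
have [f finj fsurj] := int_enum.
have [W [W1 W2 W3]] := @infinite_common_boundary R k _ _ i01.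
exists (fun j => W (f j.-1)); split.
- by move=> j _; exact: W1.
- move=> i l; rewrite /indices /= => i0 l0 il; apply: W2.
  apply/eqP => /finj /(congr1 succn); by rewrite !prednK.
- move=> q qW i _; apply: W3 => n; have [j <-] := fsurj n => Wj; apply: qW.
  by exists j.+1.
Qed.
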